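(* Let $X\in\mathcal{M}_g$ be a closed hyperbolic surface of genus $g$. There exists a constant $K_X$ (depending only on $X$) such that the following holds. For all $\varepsilon$ with $0<\varepsilon<1$ and any finite collection $\{c_i\}_{i=1}^N$ of geodesic segments on $X$ of average length $\overline{c}=\frac1N\sum_{i=1}^N\ell(c_i)$, there exists a closed geodesic $\gamma$ on $X$ such that $$\ell(\gamma)\leq N\left(K_X+\overline{c}+2\log\left(\frac1\varepsilon\right)\right)$$ and, for all $i=1,\ldots,N$, $$c_i\subset B_\varepsilon(\gamma).$$
   Context: $\mathcal{M}_g$ is the moduli space of closed orientable hyperbolic surfaces of genus $g\geq 2$. $\ell(\cdot)$ denotes length, and $B_\varepsilon(\gamma)$ denotes the $\varepsilon$-neighborhood of $\gamma$ in $X$. Geodesic segments and closed geodesics are not required to be simple. *)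

(* Defs.v *)
From HB Require Import structures.
From Stdlib Require Import Relation_Operators.
From mathcomp Require Import all_boot all_order all_algebra.
From mathcomp Require Import ring.
From mathcomp Require Import all_classical all_reals all_analysis.
Set Implicit Arguments.
Unset Strict Implicit.
Unset Printing Implicit Defensive.
Import Order.TTheory GRing.Theory Num.Theory.
Import numFieldNormedType.Exports.
Local Open Scope classical_set_scope.
Local Open Scope quotient_scope.
Local Open Scope ring_scope.

Definition homeomorphic (X Y : topologicalType) : Prop :=
  exists (f : X -> Y) (g : Y -> X),
    [/\ cancel f g, cancel g f, continuous f & continuous g].

(* The upper half-plane {x + iy | y > 0}, with x + iy encoded as (x, y). *)
Definition half_plane (R : realType) : set (R * R) := [set z | 0 < z.2].
Arguments half_plane : clear implicits.

Definition arcosh (R : realType) (t : R) : R := ln (t + Num.sqrt (t ^+ 2 - 1)).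

(* Distance of the metric (dx^2 + dy^2) / y^2 of constant curvature -1. *)
Definition hdist (R : realType) (z w : half_plane R) : R :=
  let: (x1, y1) := val z in let: (x2, y2) := val w in
  arcosh (1 + ((x1 - x2) ^+ 2 + (y1 - y2) ^+ 2) / (2 * y1 * y2)).

(* Real and imaginary parts of (a z + b) / (c z + d) at z = x + iy, for a
   matrix of determinant 1. *)
Definition mobius (R : realType) (A : 'M[R]_2) (z : R * R) : R * R :=
  let: (x, y) := z in
  let a := A 0 0 in let b := A 0 1 in let c := A 1 0 in let d := A 1 1 in
  let n := (c * x + d) ^+ 2 + (c * y) ^+ 2 in
  (((a * x + b) * (c * x + d) + a * c * y ^+ 2) / n, y / n).

(* A discrete subgroup of SL(2, R) whose image in PSL(2, R) acts freely on the
   half-plane.  A subgroup of PSL(2, R) is represented by any subgroup of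
   SL(2, R) above it, whether or not it contains -1. *)
Record fuchsian_group (R : realType) := FuchsianGroup {
  fuchsian_set : set 'M[R]_2;
  fuchsian_det : forall A, fuchsian_set A -> \det A = 1;
  fuchsian1 : fuchsian_set 1;
  fuchsianM : forall A B,
    fuchsian_set A -> fuchsian_set B -> fuchsian_set (A * B);
  fuchsianV : forall A, fuchsian_set A -> fuchsian_set A^-1;
  fuchsian_discrete :
    \forall A \near (1 : 'M[R]_2), fuchsian_set A -> A = 1;
  fuchsian_free : forall A (z : half_plane R),
    fuchsian_set A -> mobius A (val z) = val z -> A = 1 \/ A = -1
}.

Section Quotient.
Variables (R : realType) (G : fuchsian_group R).

Definition orbit_rel : rel (half_plane R) :=
  fun z w => `[< exists2 A, fuchsian_set G A & val w = mobius A (val z) >].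

Lemma mobius1 (z : R * R) : mobius 1 z = z.
Proof.
case: z => x y; rewrite /mobius !mxE /=.
by congr pair; field.
Qed.

Lemma mobiusM (A B : 'M[R]_2) (z : half_plane R) :
  \det B = 1 -> mobius (A * B) (val z) = mobius A (mobius B (val z)).
Proof.
case: z => -[x y] /= /set_mem /= y0.
rewrite (expand_det_row _ 0) !big_ord_recl big_ord0 /cofactor !det_mx11 !mxE /=.
rewrite /mobius /= !big_ord_recl !big_ord0.
have e1 : lift ord0 ord0 = 1 :> 'I_2 by exact/val_inj.
have e0 : lift (1 : 'I_2) ord0 = 0 by exact/val_inj.
rewrite !e1 !e0 !addr0 /= expr0 mul1r /bump leq0n addn0 add0n expr1.
move: (A 0 0) (A 0 1) (A 1 0) (A 1 1) => a b c d.
move: (B 0 0) (B 0 1) (B 1 0) (B 1 1) => a' b' c' d' detB.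
set n := (c' * x + d') ^+ 2 + (c' * y) ^+ 2.
have n0 : n != 0.
  rewrite paddr_eq0 ?sqr_ge0// !sqrf_eq0; apply/negP => /andP[].
  rewrite mulf_eq0 (gt_eqF y0) orbF => + /eqP c0; rewrite c0 mul0r add0r.
  by move=> /eqP d0; move: detB; rewrite c0 d0 => /eqP; rewrite !(mulr0, add0r) eq_sym oner_eq0.
have yE : y / n = (a' * d' - b' * c') * y / n.
  by congr (_ / n); rewrite -[LHS]mul1r -detB; ring.
set M := ((c * a' + d * c') * x + (c * b' + d * d')) ^+ 2 + ((c * a' + d * c') * y) ^+ 2.
set u := ((a' * x + b') * (c' * x + d') + a' * c' * y ^+ 2).
have -> : (c * (u / n) + d) ^+ 2 + (c * (y / n)) ^+ 2 = M / n.
  by rewrite yE /M /u; move: n0; rewrite /n => n0; field.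
have -> : (a * (u / n) + b) * (c * (u / n) + d) + a * c * (y / n) ^+ 2 =
    (((a * a' + b * c') * x + (a * b' + b * d')) *
     ((c * a' + d * c') * x + (c * b' + d * d')) +
     (a * a' + b * c') * (c * a' + d * c') * y ^+ 2) / n.
  by rewrite yE /u; move: n0; rewrite /n => n0; field.
by rewrite invf_div !mulrA !divfK.
Qed.

Lemma orbit_refl : reflexive orbit_rel.
Proof.
by move=> z; apply/asboolP; exists 1; [exact: fuchsian1|rewrite mobius1].
Qed.

Lemma orbit_sym : symmetric orbit_rel.
Proof.
suff H z w : orbit_rel z w -> orbit_rel w z by move=> z w; apply/idP/idP; apply: H.
move=> /asboolP[A GA zw]; apply/asboolP; exists A^-1; first exact: fuchsianV.
rewrite zw -mobiusM ?(fuchsian_det GA)// mulVr ?mobius1//.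
by rewrite unitmxE (fuchsian_det GA) unitr1.
Qed.

Lemma orbit_trans : transitive orbit_rel.
Proof.
move=> w z u /asboolP[A GA zw] /asboolP[B GB wu]; apply/asboolP.
exists (B * A); first exact: fuchsianM.
by rewrite wu zw mobiusM ?(fuchsian_det GA).
Qed.

Definition orbit_equiv : equiv_rel (half_plane R) :=
  EquivRel orbit_rel orbit_refl orbit_sym orbit_trans.

Definition surface : Type := quotient_topology {eq_quot orbit_equiv}.
HB.instance Definition _ := Topological.on surface.
HB.instance Definition _ := Quotient.on surface.

Definition sdist (p q : surface) : R :=
  inf [set r | exists z w : half_plane R,
         [/\ \pi_surface z = p, \pi_surface w = q & r = hdist z w]].

End Quotient.

(* The closed orientable surface of genus g: the closed unit disk, its boundary
   circle being cut into 4g sides that are glued in pairs following the word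
   [a_0, b_0] ... [a_(g-1), b_(g-1)].  Side j is parametrized by t in [0, 1];
   sides 4k, 4k+1, 4k+2, 4k+3 read a_k, b_k, a_k^-1, b_k^-1. *)
Section GenusSurface.
Variables (R : realType) (g : nat).

Definition disk : set (R * R) := [set z | z.1 ^+ 2 + z.2 ^+ 2 <= 1].

Definition side (j : nat) (t : R) : R * R :=
  let theta := 2 * pi * (j%:R + t) / (4 * g)%:R in (cos theta, sin theta).

Definition glue (p q : disk) : Prop :=
  exists (k : nat) (t : R), [/\ (k < g)%N, 0 <= t <= 1 &
    (val p = side (4 * k) t /\ val q = side (4 * k + 2) (1 - t)) \/
    (val p = side (4 * k + 1) t /\ val q = side (4 * k + 3) (1 - t))].

Definition glue_rel : rel disk :=
  fun p q => `[< clos_refl_sym_trans disk glue p q >].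

Lemma glue_refl : reflexive glue_rel.
Proof. by move=> p; apply/asboolP; exact: rst_refl. Qed.

Lemma glue_sym : symmetric glue_rel.
Proof. by move=> p q; apply/asboolP/asboolP; exact: rst_sym. Qed.

Lemma glue_trans : transitive glue_rel.
Proof. by move=> q p r /asboolP pq /asboolP qr; apply/asboolP; exact: rst_trans qr. Qed.

Definition glue_equiv : equiv_rel disk :=
  EquivRel glue_rel glue_refl glue_sym glue_trans.

Definition genus_surface : topologicalType :=
  quotient_topology {eq_quot glue_equiv}.

End GenusSurface.

Record closed_hyperbolic_surface (R : realType) (g : nat) := ClosedHyperbolic {
  deck_group :> fuchsian_group R;
  closed_compact : compact [set: surface deck_group];
  closed_genus : homeomorphic (surface deck_group) (genus_surface R g)
}.

Section Geodesics.
Variables (R : realType) (G : fuchsian_group R).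
Local Notation X := (surface G).

(* Unit-speed geodesic on the interval D: a locally isometric map.  It is not
   required to be injective. *)
Definition local_geodesic (D : set R) (c : R -> X) : Prop :=
  forall t, D t -> exists2 r, 0 < r &
    forall s s', D s -> D s' -> `|s - t| < r -> `|s' - t| < r ->
      sdist (c s) (c s') = `|s - s'|.

(* The values of seg_map outside [0, seg_length] are irrelevant. *)
Record geodesic_segment := GeodesicSegment {
  seg_length : R;
  seg_map : R -> X;
  seg_length_ge0 : 0 <= seg_length;
  seg_geodesic : local_geodesic `[0, seg_length] seg_map
}.

Definition seg_points (c : geodesic_segment) : set X :=
  seg_map c @` `[0, seg_length c].

(* The length is that of one turn t in [0, closed_length], which may wind
   several times around a primitive closed geodesic. *)
Record closed_geodesic := ClosedGeodesic {
  closed_length : R;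
  closed_map : R -> X;
  closed_length_gt0 : 0 < closed_length;
  closed_periodic : forall t, closed_map (t + closed_length) = closed_map t;
  closed_is_geodesic : local_geodesic [set: R] closed_map
}.

Definition closed_points (gamma : closed_geodesic) : set X :=
  range (closed_map gamma).

Definition neighborhood (e : R) (A : set X) : set X :=
  [set p | exists2 q, A q & sdist p q < e].

End Geodesics.

(* Main.v *)
(* Write points of the half-plane as A.i with A in SL(2, R): unit-speed geodesics
   are the curves A diag(e^(t/2), e^(-t/2)).i, and 2 cosh d(A.i, B.i) is the sum of
   the squares of the entries of A^-1 B.  Compactness of the surface gives a
   constant M such that any two frames E and S are connected by an element g of the
   group for which, up to sign, all entries of E^-1 g S lie in [1, M]: the group has
   no parabolic element, hence it contains g and h such that 1, g, h, gh span the
   2x2 matrices, and this transversality is amplified by the geodesic flow.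

   Lift every segment, prolong it by T = log(1/eps) + O(1) at both ends, and connect
   the end frame of each one to the start frame of the next one, cyclically.  In the
   frame of a segment, the composite group element is a product of positive
   matrices.  It is thus hyperbolic, with its attracting fixed point beyond the end
   and its repelling fixed point before the start of the prolonged segment, so its
   axis is within O(e^(-T)) < eps of the segment; its translation length is bounded
   by the logarithm of the product of the norms of the factors. *)

Require Import Defs.
From mathcomp Require Import all_boot all_order all_algebra.
From mathcomp Require Import ring lra.
From mathcomp Require Import all_classical all_reals all_analysis.
Set Implicit Arguments.
Unset Strict Implicit.
Unset Printing Implicit Defensive.
Import Order.TTheory GRing.Theory Num.Theory.
Import numFieldNormedType.Exports.
Local Open Scope classical_set_scope.
Local Open Scope quotient_scope.
Local Open Scope ring_scope.

(** * Two-by-two matrices *)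

Section Matrix2.
Variable R : realType.
Implicit Types (A B : 'M[R]_2) (s t x y : R).

Definition mx2 (a b c d : R) : 'M[R]_2 :=
  \matrix_(i, j) if i == 0 then (if j == 0 then a else b)
                 else (if j == 0 then c else d).

Lemma mx2_00 a b c d : mx2 a b c d 0 0 = a. Proof. by rewrite mxE. Qed.
Lemma mx2_01 a b c d : mx2 a b c d 0 1 = b. Proof. by rewrite mxE. Qed.
Lemma mx2_10 a b c d : mx2 a b c d 1 0 = c. Proof. by rewrite mxE. Qed.
Lemma mx2_11 a b c d : mx2 a b c d 1 1 = d. Proof. by rewrite mxE. Qed.

Definition mx2E := (mx2_00, mx2_01, mx2_10, mx2_11).

Lemma ord2P (P : 'I_2 -> Prop) : P 0 -> P 1 -> forall i, P i.
Proof.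
move=> P0 P1 [[|[|//]]] h; last by rewrite (_ : Ordinal h = 1) //; exact/val_inj.
by rewrite (_ : Ordinal h = 0) //; exact/val_inj.
Qed.

Lemma matrix2P A B : A 0 0 = B 0 0 -> A 0 1 = B 0 1 -> A 1 0 = B 1 0 ->
  A 1 1 = B 1 1 -> A = B.
Proof.
by move=> *; apply/matrixP; apply: ord2P; apply: ord2P.
Qed.

Lemma mx2_eta A : A = mx2 (A 0 0) (A 0 1) (A 1 0) (A 1 1).
Proof. by apply: matrix2P; rewrite mx2E. Qed.

Lemma mx2P A : exists a b c d, A = mx2 a b c d.
Proof. by do 4 eexists; exact: mx2_eta. Qed.

Lemma mulmx2E A B i j : (A * B) i j = A i 0 * B 0 j + A i 1 * B 1 j.
Proof.
rewrite mxE !big_ord_recl big_ord0 addr0.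
by rewrite (_ : lift ord0 ord0 = 1) //; exact/val_inj.
Qed.

Lemma mx2M a b c d a' b' c' d' : mx2 a b c d * mx2 a' b' c' d' =
  mx2 (a * a' + b * c') (a * b' + b * d') (c * a' + d * c') (c * b' + d * d').
Proof. by apply: matrix2P; rewrite mulmx2E !mx2E. Qed.

Lemma mx2N a b c d : - mx2 a b c d = mx2 (- a) (- b) (- c) (- d).
Proof. by apply: matrix2P; rewrite mxE !mx2E. Qed.

Lemma mx2_1 : 1 = mx2 1 0 0 1.
Proof. by apply: matrix2P; rewrite !mxE. Qed.

Lemma det2 A : \det A = A 0 0 * A 1 1 - A 0 1 * A 1 0.
Proof.
rewrite (expand_det_row _ 0) !big_ord_recl big_ord0 /cofactor !det_mx11 !mxE /=.
have e1 : lift ord0 ord0 = 1 :> 'I_2 by exact/val_inj.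
have e0 : lift (1 : 'I_2) ord0 = 0 by exact/val_inj.
by rewrite !e1 !e0 /= /bump /=; ring.
Qed.

Lemma det_mx2 a b c d : \det (mx2 a b c d) = a * d - b * c.
Proof. by rewrite det2 !mx2E. Qed.

Lemma det1_unit A : \det A = 1 -> A \is a GRing.unit.
Proof. by rewrite unitmxE => ->; rewrite unitr1. Qed.

Lemma det1M A B : \det A = 1 -> \det B = 1 -> \det (A * B) = 1.
Proof. by move=> dA dB; rewrite det_mulmx dA dB mulr1. Qed.

Lemma mx2V a b c d : a * d - b * c = 1 -> (mx2 a b c d)^-1 = mx2 d (- b) (- c) a.
Proof.
move=> h; have h' : a * d = 1 + b * c by rewrite -h subrK.
have u : mx2 a b c d \is a GRing.unit.
  by apply: det1_unit; rewrite det_mx2.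
apply: (mulrI u); rewrite mulrV // mx2M mx2_1.
by congr mx2; ring: h'.
Qed.

Lemma det1V A : \det A = 1 -> \det A^-1 = 1.
Proof.
have [a [b [c [d ->]]]] := mx2P A; rewrite det_mx2 => h.
by rewrite mx2V // det_mx2 -h; ring.
Qed.

Lemma trE A : \tr A = A 0 0 + A 1 1.
Proof.
rewrite /mxtrace !big_ord_recl !big_ord0 addr0.
by rewrite (_ : lift ord0 ord0 = 1) //; exact/val_inj.
Qed.

Lemma tr_mx2 a b c d : \tr (mx2 a b c d) = a + d.
Proof. by rewrite trE !mx2E. Qed.

Lemma tr_conj A B : \det A = 1 -> \tr (A^-1 * B * A) = \tr B.
Proof.
move=> dA; transitivity (\tr (A * (A^-1 * B))); first exact: mxtrace_mulC.
by rewrite mulrA divrr ?mul1r // det1_unit.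
Qed.

(** The squared Frobenius norm. For determinant 1 it is 2 cosh of the distance from i to A.i, so
    that it turns distance bounds into bounds stable under products. *)
Definition nf A := A 0 0 ^+ 2 + A 0 1 ^+ 2 + A 1 0 ^+ 2 + A 1 1 ^+ 2.

Lemma nf_mx2 a b c d : nf (mx2 a b c d) = a ^+ 2 + b ^+ 2 + c ^+ 2 + d ^+ 2.
Proof. by rewrite /nf !mx2E. Qed.

Lemma nfN A : nf (- A) = nf A.
Proof. by have [a [b [c [d ->]]]] := mx2P A; rewrite mx2N !nf_mx2 !sqrrN. Qed.

Lemma nfV A : \det A = 1 -> nf A^-1 = nf A.
Proof.
have [a [b [c [d ->]]]] := mx2P A; rewrite det_mx2 => h.
by rewrite mx2V // !nf_mx2; ring.
Qed.

Lemma nf_ge0 A : 0 <= nf A.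
Proof. by rewrite /nf !addr_ge0 // sqr_ge0. Qed.

Lemma nf_ge2 A : \det A = 1 -> 2 <= nf A.
Proof.
have [a [b [c [d ->]]]] := mx2P A; rewrite det_mx2 nf_mx2 => h.
have : 0 <= (a - d) ^+ 2 + (b + c) ^+ 2 by rewrite addr_ge0 // sqr_ge0.
by nra.
Qed.

Lemma nfM_le A B : nf (A * B) <= nf A * nf B.
Proof.
have [a [b [c [d ->]]]] := mx2P A; have [a' [b' [c' [d' ->]]]] := mx2P B.
rewrite mx2M !nf_mx2 -subr_ge0.
have -> : (a ^+ 2 + b ^+ 2 + c ^+ 2 + d ^+ 2) *
    (a' ^+ 2 + b' ^+ 2 + c' ^+ 2 + d' ^+ 2) -
    ((a * a' + b * c') ^+ 2 + (a * b' + b * d') ^+ 2 + (c * a' + d * c') ^+ 2 +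
     (c * b' + d * d') ^+ 2) =
    (a * c' - b * a') ^+ 2 + (a * d' - b * b') ^+ 2 + (c * c' - d * a') ^+ 2 +
    (c * d' - d * b') ^+ 2 by ring.
by rewrite !addr_ge0 // sqr_ge0.
Qed.

Lemma nf_entry A i j : `|A i j| <= Num.sqrt (nf A).
Proof.
rewrite -sqrtr_sqr ler_sqrt ?nf_ge0 //; move: i j.
apply: ord2P; apply: ord2P; rewrite /nf;
  have := sqr_ge0 (A 0 0); have := sqr_ge0 (A 0 1); have := sqr_ge0 (A 1 0);
  have := sqr_ge0 (A 1 1); lra.
Qed.

Definition geo t := mx2 (expR (t / 2)) 0 0 (expR (- (t / 2))).

Lemma det_geo t : \det (geo t) = 1.
Proof. by rewrite det_mx2 mulr0 subr0 -expRD subrr expR0. Qed.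

Lemma geoD s t : geo (s + t) = geo s * geo t.
Proof.
rewrite /geo mx2M !(mulr0, mul0r, addr0, add0r) -!expRD.
by congr (mx2 (expR _) _ _ (expR _)); ring.
Qed.

Lemma geo0 : geo 0 = 1.
Proof. by rewrite /geo mul0r oppr0 expR0 -mx2_1. Qed.

Lemma geoV t : (geo t)^-1 = geo (- t).
Proof.
apply: (mulrI (det1_unit (det_geo t))); rewrite -geoD subrr geo0 mulrV //.
exact: det1_unit (det_geo t).
Qed.

End Matrix2.

(** * The hyperbolic plane *)

Section HalfPlane.
Variable R : realType.
Implicit Types (A B : 'M[R]_2) (s t x y : R) (z w : half_plane R).

Definition cosh t := (expR t + expR (- t)) / 2.

Lemma coshN t : cosh (- t) = cosh t.
Proof. by rewrite /cosh opprK addrC. Qed.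

Lemma cosh_norm t : cosh `|t| = cosh t.
Proof. by case: (ler0P t) => // _; rewrite coshN. Qed.

Lemma cosh_lt s t : 0 <= s -> s < t -> cosh s < cosh t.
Proof.
move=> s0 st; rewrite /cosh ltr_pM2r ?invr_gt0 // !expRN.
have es : 1 <= expR s by rewrite -expR0 ler_expR.
have est : expR s < expR t by rewrite ltr_expR.
move: (expR s) (expR t) es est => a b a1 ab.
rewrite -subr_gt0.
have -> : b + b^-1 - (a + a^-1) = (b - a) * (1 - (a * b)^-1).
  by field; apply/andP; split; apply: lt0r_neq0; lra.
rewrite mulr_gt0 ?subr_gt0 // invf_lt1; nra.
Qed.

Lemma cosh_le s t : 0 <= s -> s <= t -> cosh s <= cosh t.
Proof.
by move=> s0; rewrite le_eqVlt => /predU1P[->//|/(cosh_lt s0)/ltW].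
Qed.

Lemma coshD s t : cosh (s + t) = cosh s * cosh t +
  (expR s - expR (- s)) / 2 * ((expR t - expR (- t)) / 2).
Proof. by rewrite /cosh opprD !expRD; field. Qed.

Lemma cosh_sqr t : cosh t ^+ 2 - 1 = ((expR t - expR (- t)) / 2) ^+ 2.
Proof. by have := expRxMexpNx_1 t; rewrite /cosh => h; field: h. Qed.

Lemma coshK t : 0 <= t -> arcosh (cosh t) = t.
Proof.
move=> t0; rewrite /arcosh.
rewrite cosh_sqr sqrtr_sqr ger0_norm; last first.
  by rewrite divr_ge0 // subr_ge0 ler_expR; lra.
have -> : cosh t + (expR t - expR (- t)) / 2 = expR t by rewrite /cosh; field.
exact: expRK.
Qed.

Lemma arcosh_ge0 t : 1 <= t -> 0 <= arcosh t.
Proof. by move=> t1; rewrite ln_ge0 // (le_trans t1) // lerDl sqrtr_ge0. Qed.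

Lemma arcoshK t : 1 <= t -> cosh (arcosh t) = t.
Proof.
move=> t1; have h : 0 <= t ^+ 2 - 1 by nra.
have := sqrtr_ge0 (t ^+ 2 - 1); have := sqr_sqrtr h.
rewrite /cosh expRN /arcosh; set u := Num.sqrt _ => uE u0.
rewrite lnK ?posrE; last by lra.
have -> : (t + u)^-1 = t - u.
  by apply: (mulIf (x := t + u)); [apply: lt0r_neq0; lra|rewrite mulVf; [nra|apply: lt0r_neq0; lra]].
by field.
Qed.

Lemma arcosh_lt s t : 1 <= s -> s < t -> arcosh s < arcosh t.
Proof.
move=> s1 st; rewrite ltNge; apply/negP => ts.
have := cosh_le (arcosh_ge0 (le_trans s1 (ltW st))) ts.
by rewrite !arcoshK ?(le_trans s1 (ltW st)) // leNgt st.
Qed.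

Lemma arcosh_lt_cosh s t : 1 <= s -> 0 <= t -> (arcosh s < t) = (s < cosh t).
Proof.
move=> s1 t0; apply/idP/idP => [/(cosh_lt (arcosh_ge0 s1))|]; first by rewrite arcoshK.
by move=> /(arcosh_lt s1); rewrite coshK.
Qed.

Lemma arcosh_small x : 0 <= x <= 1 -> arcosh (1 + x ^+ 2 / 2) <= 2 * x.
Proof.
move=> /andP[x0 x1]; rewrite /arcosh.
have h : Num.sqrt ((1 + x ^+ 2 / 2) ^+ 2 - 1) <= 3 / 2 * x.
  rewrite -[leRHS]ger0_norm; last by nra.
  rewrite -sqrtr_sqr ler_sqrt ?sqr_ge0 //.
  have : 0 <= x ^+ 2 * (1 - x ^+ 2) by rewrite mulr_ge0 ?sqr_ge0 //; nra.
  by nra.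
have s0 := sqrtr_ge0 ((1 + x ^+ 2 / 2) ^+ 2 - 1).
rewrite -addrA; apply: (le_trans (le_ln1Dx _)); nra.
Qed.

Lemma half_planeP z : exists x y, val z = (x, y) /\ 0 < y.
Proof.
case: z => -[x y] h; exists x, y; split=> //.
by move: h => /set_mem.
Qed.

Definition chd z w : R :=
  1 + (((val z).1 - (val w).1) ^+ 2 + ((val z).2 - (val w).2) ^+ 2) /
      (2 * (val z).2 * (val w).2).

Lemma hdistE z w : hdist z w = arcosh (chd z w).
Proof. by rewrite /hdist /chd; case: (val z) (val w) => ? ? [? ?]. Qed.

Lemma chd_ge1 z w : 1 <= chd z w.
Proof.
have [x [y [ez y0]]] := half_planeP z; have [x' [y' [ew y0']]] := half_planeP w.
rewrite /chd ez ew /= lerDl divr_ge0 ?addr_ge0 ?sqr_ge0 //.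
by rewrite !mulr_ge0 // ltW.
Qed.

Lemma chdC z w : chd z w = chd w z.
Proof. by rewrite /chd; congr (1 + _ / _); ring. Qed.

Lemma chdxx z : chd z z = 1.
Proof. by rewrite /chd !subrr expr0n /= addr0 mul0r addr0. Qed.

Lemma chd_eq1 z w : chd z w = 1 -> z = w.
Proof.
have [x [y [ez y0]]] := half_planeP z; have [x' [y' [ew y0']]] := half_planeP w.
rewrite /chd ez ew /= => /eqP; rewrite -subr_eq0 addrAC subrr add0r mulf_eq0.
rewrite invr_eq0 !mulf_eq0 pnatr_eq0 /= (gt_eqF y0) (gt_eqF y0') !orbF.
rewrite paddr_eq0 ?sqr_ge0 // !sqrf_eq0 !subr_eq0 => /andP[/eqP xx /eqP yy].
by apply: val_inj; rewrite ez ew xx yy.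
Qed.

Lemma hdist_ge0 z w : 0 <= hdist z w.
Proof. by rewrite hdistE arcosh_ge0 // chd_ge1. Qed.

Lemma cosh_hdist z w : cosh (hdist z w) = chd z w.
Proof. by rewrite hdistE arcoshK // chd_ge1. Qed.

Lemma hdist_lt z w t : 0 <= t -> (hdist z w < t) = (chd z w < cosh t).
Proof. by move=> t0; rewrite hdistE arcosh_lt_cosh // chd_ge1. Qed.

(* The Gram matrix of three vectors of the hyperboloid has nonpositive
   determinant; its entries are the hyperbolic cosines of the distances. *)
Lemma chd_gram u z w :
  (chd z w - chd z u * chd u w) ^+ 2 <= (chd z u ^+ 2 - 1) * (chd u w ^+ 2 - 1).
Proof.
have [x [y [ez y0]]] := half_planeP z; have [x' [y' [ew y0']]] := half_planeP w.
have [x0 [b [eu b0]]] := half_planeP u.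
rewrite /chd ez ew eu /= -subr_ge0.
set D := (x - x0) * (x' ^+ 2 + y' ^+ 2 - x0 ^+ 2 - b ^+ 2) -
  (x' - x0) * (x ^+ 2 + y ^+ 2 - x0 ^+ 2 - b ^+ 2).
rewrite [leRHS](_ : _ = (D / (2 * y * y' * b)) ^+ 2) ?sqr_ge0 //.
by rewrite /D; field; rewrite !lt0r_neq0.
Qed.

Lemma hdist_triangle u z w : hdist z w <= hdist z u + hdist u w.
Proof.
have a0 := hdist_ge0 z u; have b0 := hdist_ge0 u w.
have sinh0 t : 0 <= t -> 0 <= (expR t - expR (- t)) / 2.
  by move=> t0; rewrite divr_ge0 // subr_ge0 ler_expR; lra.
have : chd z w <= cosh (hdist z u + hdist u w).
  rewrite coshD !cosh_hdist -lerBlDl (le_trans (ler_norm _)) //.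
  rewrite -[leRHS]ger0_norm; last by rewrite mulr_ge0 // sinh0.
  rewrite -!sqrtr_sqr ler_wsqrtr // exprMn -!cosh_sqr !cosh_hdist.
  exact: chd_gram.
by rewrite leNgt -cosh_hdist => h; rewrite leNgt; apply: contra h => /cosh_lt; apply; exact: addr_ge0.
Qed.
End HalfPlane.

(** * Frames in SL(2, R), points and geodesics of the half-plane *)

Section Points.
Variable R : realType.
Implicit Types (A B : 'M[R]_2) (s t x y : R) (z w : half_plane R).

Lemma half_plane_i : (0, 1) \in half_plane R.
Proof. by apply/mem_set; rewrite /half_plane /=. Qed.

(** The point A.i; the default value i is never reached when [\det A = 1]. *)
Definition pt A : half_plane R :=
  insubd (Sub (0, 1) half_plane_i : half_plane R) (mobius A (0, 1)).

Lemma det1_row A : \det A = 1 -> 0 < A 1 0 ^+ 2 + A 1 1 ^+ 2.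
Proof.
have [a [b [c [d ->]]]] := mx2P A; rewrite det_mx2 !mx2E => h.
rewrite lt_neqAle addr_ge0 ?sqr_ge0 // andbT eq_sym paddr_eq0 ?sqr_ge0 //.
rewrite !sqrf_eq0; apply/negP => /andP[/eqP c0 /eqP d0].
by move: h; rewrite c0 d0 !mulr0 subr0 => /eqP; rewrite eq_sym oner_eq0.
Qed.

Lemma ptE A : \det A = 1 -> val (pt A) =
  ((A 0 0 * A 1 0 + A 0 1 * A 1 1) / (A 1 0 ^+ 2 + A 1 1 ^+ 2),
   (A 1 0 ^+ 2 + A 1 1 ^+ 2)^-1).
Proof.
move=> /det1_row n0; rewrite /pt /mobius insubdK.
  by rewrite div1r; congr (_ / _, _^-1); ring.
apply/mem_set; rewrite /half_plane /= mulr0 add0r mulr1 addrC.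
by rewrite div1r invr_gt0.
Qed.

Lemma val_pt A : \det A = 1 -> val (pt A) = mobius A (0, 1).
Proof.
move=> dA; rewrite ptE // /mobius.
by rewrite div1r; congr (_ / _, _^-1); ring.
Qed.

Lemma mobius_pt A B : \det A = 1 -> \det B = 1 ->
  mobius A (val (pt B)) = val (pt (A * B)).
Proof.
move=> dA dB; rewrite [RHS]val_pt ?det1M // val_pt //.
exact/esym/(mobiusM A (Sub (0, 1) half_plane_i : half_plane R) dB).
Qed.

Lemma pt_surj z : exists2 A, \det A = 1 & z = pt A.
Proof.
have [x [y [ez y0]]] := half_planeP z; have s0 : 0 < Num.sqrt y by rewrite sqrtr_gt0.
have sE := sqr_sqrtr (ltW y0).
have dA : \det (mx2 (Num.sqrt y) (x / Num.sqrt y) 0 (Num.sqrt y)^-1) = 1.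
  by rewrite det_mx2 mulr0 subr0 divff // lt0r_neq0.
exists (mx2 (Num.sqrt y) (x / Num.sqrt y) 0 (Num.sqrt y)^-1) => //.
apply: val_inj; rewrite ez ptE // !mx2E expr0n mulr0 !add0r exprVn invrK sE.
by congr pair; field: sE; rewrite !lt0r_neq0.
Qed.

Lemma chd_pt A B : \det A = 1 -> \det B = 1 ->
  chd (pt A) (pt B) = nf (A^-1 * B) / 2.
Proof.
move=> dA dB; have := det1_row dA; have := det1_row dB.
rewrite /chd !ptE //=; move: dA dB.
have [a [b [c [d ->]]]] := mx2P A; have [a' [b' [c' [d' ->]]]] := mx2P B.
rewrite !det_mx2 => hA hB; rewrite mx2V // mx2M nf_mx2 !mx2E => n0' n0.
have e : a ^+ 2 + b ^+ 2 = ((a * c + b * d) ^+ 2 + 1) / (c ^+ 2 + d ^+ 2).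
  by rewrite -[1](expr1n _ 2) -hA; field; rewrite lt0r_neq0.
have e' : a' ^+ 2 + b' ^+ 2 = ((a' * c' + b' * d') ^+ 2 + 1) / (c' ^+ 2 + d' ^+ 2).
  by rewrite -[1](expr1n _ 2) -hB; field; rewrite lt0r_neq0.
set n := c ^+ 2 + d ^+ 2 in n0 e *; set n' := c' ^+ 2 + d' ^+ 2 in n0' e' *.
set X := a * c + b * d in e *; set X' := a' * c' + b' * d' in e' *.
have -> : (d * a' + - b * c') ^+ 2 + (d * b' + - b * d') ^+ 2 +
   (- c * a' + a * c') ^+ 2 + (- c * b' + a * d') ^+ 2 =
   n * (a' ^+ 2 + b' ^+ 2) + (a ^+ 2 + b ^+ 2) * n' - 2 * X * X'.
  by rewrite /n /n' /X /X'; ring.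
by rewrite e e'; field; rewrite !lt0r_neq0.
Qed.

Lemma pt_eq A B : \det A = 1 -> \det B = 1 -> nf (A^-1 * B) = 2 -> pt A = pt B.
Proof. by move=> dA dB h; apply: chd_eq1; rewrite chd_pt // h divff. Qed.

Lemma chd_ptM C A B : \det C = 1 -> \det A = 1 -> \det B = 1 ->
  chd (pt (C * A)) (pt (C * B)) = chd (pt A) (pt B).
Proof.
move=> dC dA dB; rewrite !chd_pt ?det1M // invrM ?det1_unit //.
by rewrite -mulrA (mulrA C^-1) mulVr ?mul1r ?det1_unit.
Qed.

Lemma ptMl C A B : \det C = 1 -> \det A = 1 -> \det B = 1 ->
  pt A = pt B -> pt (C * A) = pt (C * B).
Proof. by move=> dC dA dB e; apply: chd_eq1; rewrite chd_ptM // e chdxx. Qed.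

Lemma det2N A : \det (- A) = \det A.
Proof. by rewrite !det2 !mxE; ring. Qed.

Lemma ptN A : \det A = 1 -> pt (- A) = pt A.
Proof.
move=> dA; apply: pt_eq => //; first by rewrite det2N.
rewrite invrN mulNr nfN mulVr ?det1_unit // mx2_1 nf_mx2; ring.
Qed.

Lemma nf_geoM t A : nf (geo t * A) =
  expR t * (A 0 0 ^+ 2 + A 0 1 ^+ 2) + expR (- t) * (A 1 0 ^+ 2 + A 1 1 ^+ 2).
Proof.
have [a [b [c [d ->]]]] := mx2P A; rewrite /geo mx2M nf_mx2 !mx2E.
have -> : expR t = expR (t / 2) ^+ 2.
  by rewrite expr2 -expRD; congr expR; field.
have -> : expR (- t) = expR (- (t / 2)) ^+ 2.
  by rewrite expr2 -expRD; congr expR; field.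
ring.
Qed.

Lemma nf_geo t : nf (geo t) = 2 * cosh t.
Proof. by rewrite -[geo t]mulr1 nf_geoM mx2_1 !mx2E /cosh; field. Qed.

Lemma chd_geo A s t : \det A = 1 ->
  chd (pt (A * geo s)) (pt (A * geo t)) = cosh (t - s).
Proof.
move=> dA; rewrite chd_ptM ?chd_pt ?det_geo // geoV -geoD nf_geo.
by rewrite mulrAC divff // mul1r addrC.
Qed.

(** In the frame [A], cosh of the distance from the point at time s' to [z] is (e^(-s') p + e^(s')
    r) / 2, with p and r the squared row norms of the matrix of [z]. Two distinct times force p =
    e^s and r = e^(-s), as for the point at time [s]. *)
Lemma geo_rigid A z s0 s1 s : \det A = 1 -> s0 != s1 ->
  chd (pt (A * geo s0)) z = cosh (s - s0) ->
  chd (pt (A * geo s1)) z = cosh (s - s1) -> z = pt (A * geo s).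
Proof.
have [B dB ->] := pt_surj z => dA s01.
have -> : B = A * (A^-1 * B) by rewrite mulrA divrr ?mul1r ?det1_unit.
have : \det (A^-1 * B) = 1 by rewrite det1M ?det1V.
move: (A^-1 * B) => m dm.
have chdE s' : chd (pt (A * geo s')) (pt (A * m)) = (expR (- s') *
    (m 0 0 ^+ 2 + m 0 1 ^+ 2) + expR s' * (m 1 0 ^+ 2 + m 1 1 ^+ 2)) / 2.
  rewrite (chd_ptM dA (det_geo _) dm) (chd_pt (det_geo _) dm) geoV nf_geoM.
  by rewrite [in - - s']opprK.
have := nf_geoM (- s) m; rewrite [in - - s]opprK !chdE {chdE}.
move: (_ ^+ 2 + _) (m 1 0 ^+ 2 + _) => p r nfE h0 h1.
(* After multiplication by e^(s - s'), one side no longer depends on s'; comparing two times makes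
   both sides vanish. *)
have key s' : (expR (- s') * p + expR s' * r) / 2 = cosh (s - s') ->
    (expR (- s) * p - 1) * expR (s - s') ^+ 2 = 1 - expR s * r.
  move=> h; have h2 : expR (- s') * p + expR s' * r = expR (s - s') + expR (s' - s).
    by apply: (mulIf (x := 2^-1)); [rewrite invr_eq0|rewrite h /cosh opprB].
  have e1 : expR (- s') = expR (s - s') * expR (- s) by rewrite -expRD; congr expR; ring.
  have e2 : expR s' = expR (s' - s) * expR s by rewrite -expRD; congr expR; ring.
  have e3 : expR (s' - s) * expR (s - s') = 1 by rewrite -expRD -expR0; congr expR; ring.
  move: h2; rewrite e1 e2 => h2.
  have : expR (s - s') * (expR (s - s') * expR (- s) * p + expR (s' - s) * expR s * r) =
    expR (s - s') * (expR (s - s') + expR (s' - s)) by rewrite h2.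
  move: e3; move: (expR (s - s')) (expR (s' - s)) (expR (- s)) (expR s) => u v a b e3 h3.
  have -> : b * r = (v * u) * b * r by rewrite e3 mul1r.
  by rewrite -[X in X - _ * _ * _]e3; move: h3; lra.
have {}h0 := key _ h0; have {}h1 := key _ h1.
have P1 : expR (- s) * p = 1.
  apply/eqP; rewrite -subr_eq0; move/eqP: (h0); rewrite -h1 -subr_eq0 -mulrBr mulf_eq0.
  case/orP => //; rewrite subr_sqr mulf_eq0 => /orP[|].
    by move=> /eqP/subr0_eq h; have /addrI/oppr_inj/eqP := @expR_inj R _ _ h; rewrite (negPf s01).
  by rewrite paddr_eq0 ?expR_ge0 // gt_eqF ?expR_gt0.
have R1 : expR s * r = 1.
  by move: h0; rewrite P1 subrr mul0r => h; lra.
apply/esym/pt_eq; rewrite ?det1M ?det_geo // invrM ?det1_unit ?det_geo //.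
rewrite -mulrA (mulrA A^-1) mulVr ?det1_unit // mul1r geoV nfE P1 R1.
by ring.
Qed.

Lemma geo_unique A B s0 s1 : \det A = 1 -> \det B = 1 -> s0 != s1 ->
  pt (A * geo s0) = pt (B * geo s0) -> pt (A * geo s1) = pt (B * geo s1) ->
  forall s, pt (A * geo s) = pt (B * geo s).
Proof.
move=> dA dB s01 e0 e1 s; apply: (geo_rigid dB s01).
  by rewrite -e0 chd_geo.
by rewrite -e1 chd_geo.
Qed.

(** The eigenvector is (l - r, q), normalized; if it vanishes, the symmetric matrix is diagonal with
    lower entry [l], and (0, 1) serves. *)
Lemma unit_eigenvector p q r l : p * r - q ^+ 2 = 1 -> l * (p + r - l) = 1 ->
  exists x y, [/\ x ^+ 2 + y ^+ 2 = 1 :> R, p * x + q * y = l * x & q * x + r * y = l * y].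
Proof.
move=> h hl; have [/eqP|n0] := eqVneq ((l - r) ^+ 2 + q ^+ 2) 0.
  rewrite paddr_eq0 ?sqr_ge0 // !sqrf_eq0 subr_eq0 => /andP[/eqP -> /eqP ->].
  by exists 0, 1; split; ring.
have n1 : 0 < (l - r) ^+ 2 + q ^+ 2.
  by rewrite lt_neqAle eq_sym n0 addr_ge0 // sqr_ge0.
set n := Num.sqrt ((l - r) ^+ 2 + q ^+ 2).
have nn : n != 0 by rewrite lt0r_neq0 // sqrtr_gt0.
exists ((l - r) / n), (q / n); split.
- rewrite !expr_div_n -mulrDl sqr_sqrtr ?divff // ltW //.
- rewrite !mulrA -mulrDl; congr (_ / _).
  by move: h hl; lra.
- by rewrite !mulrA -mulrDl; congr (_ / _); ring.
Qed.

(** Cartan decomposition: if m is the matrix of [w] in a frame at [z], then m m^T has eigenvalues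
    e^t and e^(-t). The rotation given by a unit eigenvector fixes i and points the geodesic at
    m.i. *)
Lemma geo_from z w t : chd z w = cosh t ->
  exists2 A, \det A = 1 & z = pt A /\ w = pt (A * geo t).
Proof.
have [A dA ->] := pt_surj z; have [B dB ->] := pt_surj w.
have -> : B = A * (A^-1 * B) by rewrite mulrA divrr ?mul1r ?det1_unit.
have : \det (A^-1 * B) = 1 by rewrite det1M ?det1V.
move: (A^-1 * B) => {B dB} m dm.
have -> : chd (pt A) (pt (A * m)) = nf m / 2.
  by rewrite -{1}[A]mulr1 (chd_ptM dA (det1 _ _) dm) (chd_pt (det1 _ _) dm) invr1 mul1r.
have [a [b [c [d em]]]] := mx2P m; rewrite em nf_mx2 => ht.
move: (dm); rewrite em det_mx2 => hm.
have ll : expR t * expR (- t) = 1 by rewrite expRxMexpNx_1.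
have hl : expR t * ((a ^+ 2 + b ^+ 2) + (c ^+ 2 + d ^+ 2) - expR t) = 1.
  rewrite -ll; congr (_ * _); move: ht; rewrite /cosh; lra.
have hp : (a ^+ 2 + b ^+ 2) * (c ^+ 2 + d ^+ 2) - (a * c + b * d) ^+ 2 = 1.
  by rewrite -[RHS](expr1n _ 2) -hm; ring.
have [x [y [xy e1 e2]]] := unit_eigenvector hp hl.
have dk : \det (mx2 x (- y) y x) = 1 by rewrite det_mx2 -xy; ring.
exists (A * mx2 x (- y) y x); first by rewrite det1M.
split.
  apply: pt_eq; rewrite ?det1M // mulrA mulVr ?mul1r ?det1_unit //.
  by rewrite nf_mx2 sqrrN -xy; ring: xy.
rewrite -mulrA; apply: ptMl; rewrite ?det1M ?det_geo //.
  by rewrite det_mx2.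
apply: pt_eq; rewrite ?det1M ?det_geo // ?det_mx2 //.
rewrite mx2V //.
set l := expR t in ll hl e1 e2; set k := expR (- t) in ll.
have el : expR (t / 2) ^+ 2 = l by rewrite expr2 -expRD; congr expR; field.
have ek : expR (- (t / 2)) ^+ 2 = k by rewrite expr2 -expRD; congr expR; field.
rewrite /geo !mx2M nf_mx2.
set L := expR (t / 2) in el *; set K := expR _ in ek *.
transitivity (l * ((c ^+ 2 + d ^+ 2) * x ^+ 2 + (a ^+ 2 + b ^+ 2) * y ^+ 2 - 2 * (a * c + b * d) * x * y)
  + k * ((a ^+ 2 + b ^+ 2) * x ^+ 2 + (c ^+ 2 + d ^+ 2) * y ^+ 2 + 2 * (a * c + b * d) * x * y)).
  by rewrite -el -ek; ring.
move: e1 e2 hl; move: (a ^+ 2 + b ^+ 2) (c ^+ 2 + d ^+ 2) (a * c + b * d) => p r q e1 e2 hl.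
have s1 : p * x ^+ 2 + r * y ^+ 2 + 2 * q * x * y = l.
  transitivity (x * (p * x + q * y) + y * (q * x + r * y)); first by ring.
  by rewrite e1 e2 -[RHS]mulr1 -xy; ring.
have s2 : r * x ^+ 2 + p * y ^+ 2 - 2 * q * x * y = p + r - l.
  transitivity ((p + r) * (x ^+ 2 + y ^+ 2) - l); first by rewrite -s1; ring.
  by rewrite xy mulr1.
by rewrite s1 s2 hl mulrC ll.
Qed.

End Points.

(** * Compact quotients *)

Section Surface.
Variables (R : realType) (G : fuchsian_group R).
Implicit Types (A B g : 'M[R]_2) (z w : half_plane R).
Local Notation X := (surface G).

Lemma pi_pt A B : \det A = 1 -> \det B = 1 ->
  \pi_X (pt A) = \pi_X (pt B) <-> exists2 g, fuchsian_set G g & pt B = pt (g * A).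
Proof.
move=> dA dB; split.
  move=> /eqquotP/asboolP[g Gg e]; exists g => //; apply: val_inj.
  by rewrite -mobius_pt // (fuchsian_det Gg).
move=> [g Gg e]; apply/eqquotP/asboolP; exists g => //.
by rewrite mobius_pt ?(fuchsian_det Gg) // e.
Qed.

Lemma pi_ptM g A : fuchsian_set G g -> \det A = 1 ->
  \pi_X (pt (g * A)) = \pi_X (pt A).
Proof.
move=> Gg dA; apply/esym/pi_pt => //; last by exists g.
by rewrite det1M // (fuchsian_det Gg).
Qed.

Lemma pi_surj (p : X) : exists2 A, \det A = 1 & p = \pi_X (pt A).
Proof.
elim/quotW: p => z; have [A dA ->] := pt_surj z; by exists A.
Qed.

Lemma continuous_chd z : continuous (chd z : half_plane R -> R).
Proof.
move=> w; rewrite /chd.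
have [x [y [ew y0]]] := half_planeP w; have [x' [y' [ez y0']]] := half_planeP z.
have cv : {for w, continuous (fun u : half_plane R => val u)}.
  exact: (@initial_continuous (half_plane R) (R * R)%type set_val).
have c1 : (val u).1 @[u --> w] --> (val w).1.
  by apply: (@continuous_comp _ _ _ (fun u : half_plane R => val u) fst w cv); exact: cvg_fst.
have c2 : (val u).2 @[u --> w] --> (val w).2.
  by apply: (@continuous_comp _ _ _ (fun u : half_plane R => val u) snd w cv); exact: cvg_snd.
rewrite /continuous_at; apply: (@cvgD R R _ (nbhs w) _ (fun=> 1)); first exact: cvg_cst.
apply: (@cvgM R _ (nbhs w)).
  under eq_fun do rewrite !expr2.
  rewrite !expr2; apply: (@cvgD R R _ (nbhs w)); apply: (@cvgM R _ (nbhs w));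
    by apply: (@cvgB R R _ (nbhs w)) => //; exact: cvg_cst.
apply: (@cvgV R _ (nbhs w)).
  by rewrite ez ew /= !mulf_neq0 // ?lt0r_neq0.
by apply: (@cvgM R _ (nbhs w)) => //; exact: cvg_cst.
Qed.

Lemma nf_chd g A : \det g = 1 -> \det A = 1 -> nf (g * A) = 2 * chd (pt g^-1) (pt A).
Proof.
by move=> dg dA; rewrite chd_pt ?det1V // invrK mulrC divfK.
Qed.

(** Boundedness of a fundamental domain: [nf] measures the distance to i. *)
Definition cocompact := exists M : R, forall A, \det A = 1 ->
  exists2 g, fuchsian_set G g & nf (g * A) <= M.

Lemma compact_cocompact : compact [set: X] -> cocompact.
Proof.
move=> /compact_near_coveringP.
(* [P n] is the image of a ball around i. These open sets increase with n and cover the surface, so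
   compactness leaves a single one. *)
pose P (n : nat) (p : X) := exists2 A, \det A = 1 & p = \pi_X (pt A) /\ nf A < n%:R.
move=> /(_ nat \oo P _) [].
- move=> p _; have [A0 dA0 ep] := pi_surj p.
  have nA := archi_boundP (nf_ge0 A0); set n := Num.bound _ in nA.
  have oU : open [set q | P n q].
    rewrite /open /= /quotient_open openE => z /= [A dA [eA nfA]].
    have [B dB eB] := pt_surj z; move: eA; rewrite eB => /(pi_pt dB dA)[g Gg eg].
    have dg := fuchsian_det Gg.
    have : \forall w \near pt B, chd (pt g^-1) w < n%:R / 2.
      apply: (cvgr_lt _ (@continuous_chd (pt g^-1) (pt B))).
      rewrite ltr_pdivlMr // mulrC -nf_chd //.
      by rewrite -[g * B]mul1r nf_chd ?det1 ?det1M // -eg -nf_chd ?det1 // mul1r.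
    rewrite /interior; apply: filterS => w; have [C dC ->] := pt_surj w => h.
    exists (g * C); first by rewrite det1M.
    by rewrite pi_ptM // nf_chd // mulrC -ltr_pdivlMr.
  exists ([set q | P n q], [set i | (n <= i)%N]).
    split; last by exists n.
    by apply: open_nbhs_nbhs; split=> //=; exists A0.
  move=> [q i] /= [[A dA [-> nfA]] ni]; exists A => //; split=> //.
  by apply: lt_le_trans nfA _; rewrite ler_nat.
- move=> n _ /(_ n (leqnn n)) cov; exists n%:R => A dA.
  have [B dB [/(pi_pt dA dB)[g Gg eg] nfB]] := cov (\pi_X (pt A)) I.
  have dg := fuchsian_det Gg.
  exists g => //; rewrite -[g * A]mul1r nf_chd ?det1 ?det1M // -eg.
  by rewrite -nf_chd ?det1 // mul1r ltW.
Qed.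

Lemma discrete_nf : exists2 e : R, 0 < e &
  forall g, fuchsian_set G g -> nf (g - 1) < e -> g = 1.
Proof.
have /nbhs_ballP[e /= e0 he] := fuchsian_discrete G.
exists (e ^+ 2); first by rewrite exprn_gt0.
move=> g Gg h; apply: he => //; split=> // i j.
rewrite -ball_normE /= distrC.
have := nf_entry (g - 1) i j; rewrite !mxE => /le_lt_trans; apply.
by rewrite -[ltRHS]ger0_norm ?ltW // -sqrtr_sqr ltr_sqrt // exprn_gt0.
Qed.

Lemma mul_self_eq1 A : \det A = 1 -> A * A = 1 -> A = 1 \/ A = -1.
Proof.
move=> dA AA; have : A = A^-1.
  by apply: (mulrI (det1_unit dA)); rewrite AA divrr // det1_unit.
have [a [b [c [d e]]]] := mx2P A; move: (dA); rewrite e det_mx2 => h.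
rewrite mx2V // => /matrixP H.
have := H 0 0; have := H 0 1; have := H 1 0; rewrite !mx2E => c0 b0 ad.
have {}c0 : c = 0 by lra. have {}b0 : b = 0 by lra.
have : (a - 1) * (a + 1) = 0 by move: h; rewrite b0 -ad; lra.
move=> /eqP; rewrite mulf_eq0 subr_eq0 addr_eq0 mx2_1 -ad c0 b0.
by case/orP => /eqP ->; [left|right]; rewrite ?mx2N ?oppr0.
Qed.

(** The fixed point is the root of c z^2 + (d - a) z - b = 0 in the upper half-plane; c = 0 would
    give a d = 1 and a trace of absolute value at least 2. *)
Lemma elliptic_fixpoint A : \det A = 1 -> `|\tr A| < 2 ->
  exists z : half_plane R, mobius A (val z) = val z.
Proof.
have [a [b [c [d ->]]]] := mx2P A; rewrite det_mx2 tr_mx2 => h.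
rewrite ltr_norml => /andP[t1 t2].
have tt : 0 < 4 - (a + d) ^+ 2 by nra.
have c0 : c != 0.
  by apply: contraTneq tt => c0; rewrite -leNgt; move: h; rewrite c0; have := sqr_ge0 (a - d); nra.
have y0 : 0 < Num.sqrt (4 - (a + d) ^+ 2) / (2 * `|c|).
  by rewrite divr_gt0 ?sqrtr_gt0 // mulr_gt0 // normr_gt0.
exists (Sub ((a - d) / (2 * c), Num.sqrt (4 - (a + d) ^+ 2) / (2 * `|c|)) (mem_set y0)).
rewrite /= /mobius !mx2E.
have n1 : (c * ((a - d) / (2 * c)) + d) ^+ 2 +
    (c * (Num.sqrt (4 - (a + d) ^+ 2) / (2 * `|c|))) ^+ 2 = 1.
  rewrite !exprMn exprVn exprMn real_normK ?num_real // sqr_sqrtr ?ltW //.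
  by field.
rewrite n1 !divr1; congr pair.
rewrite exprMn exprVn exprMn real_normK ?num_real // sqr_sqrtr ?ltW //.
have -> : b = (a * d - 1) / c by rewrite -h; field.
by field.
Qed.

End Surface.

(** * Injectivity radius and local isometry of the projection *)

Section Injectivity.
Variables (R : realType) (G : fuchsian_group R).
Implicit Types (A B g : 'M[R]_2) (z w : half_plane R).
Local Notation X := (surface G).

(** Determinant 1 gives nf A + 2 = (a + d)^2 + (b - c)^2 and nf A - 2 = (a - d)^2 + (b + c)^2. With
    the trace at least 2, almost minimal norm makes a + d - 2, b - c, a - d and b + c all small. *)
Lemma nf_sub1_le A r : \det A = 1 -> nf A < 2 + r -> r <= 1 -> 2 <= \tr A ->
  nf (A - 1) <= 2 * r.
Proof.
have [a [b [c [d ->]]]] := mx2P A; rewrite det_mx2 nf_mx2 tr_mx2 => h nA r1 t2.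
rewrite mx2_1 mx2N (_ : _ + _ = mx2 (a - 1) b c (d - 1)); last first.
  by apply: matrix2P; rewrite mxE !mx2E ?oppr0 ?addr0.
rewrite nf_mx2.
have := sqr_ge0 (a - d); have := sqr_ge0 (b + c); have := sqr_ge0 (b - c) => p1 p2 p3.
have q : (a + d) ^+ 2 < 4 + r by nra.
have q2 : (a + d - 2) ^+ 2 <= r / 4 by nra.
have q3 : (b - c) ^+ 2 <= r by nra.
have q4 : (a - d) ^+ 2 + (b + c) ^+ 2 <= r by nra.
nra.
Qed.

Lemma nfD_le A B : nf (A + B) <= 2 * nf A + 2 * nf B.
Proof.
have [a [b [c [d ->]]]] := mx2P A; have [a' [b' [c' [d' ->]]]] := mx2P B.
rewrite (_ : _ + _ = mx2 (a + a') (b + b') (c + c') (d + d')); last first.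
  by apply: matrix2P; rewrite mxE !mx2E.
rewrite !nf_mx2; have := sqr_ge0 (a - a'); have := sqr_ge0 (b - b').
have := sqr_ge0 (c - c'); have := sqr_ge0 (d - d'); lra.
Qed.

(* A non-elliptic element of small displacement has trace close to 2 or -2 and
   is therefore conjugate, by a bounded matrix, to a matrix close to 1 or -1.
   Since -1 need not lie in the group, discreteness is applied to its square. *)
Lemma injectivity_nf : cocompact G -> exists2 r : R, 0 < r &
  forall A g, \det A = 1 -> fuchsian_set G g -> nf (A^-1 * g * A) < 2 + r ->
  g = 1 \/ g = -1.
Proof.
move=> [M hM]; have [e e0 he] := discrete_nf G.
have M2 : 2 <= M.
  have [g Gg h] := hM 1 (det1 _ _); apply: le_trans h.
  by rewrite nf_ge2 // det1M ?det1 ?(fuchsian_det Gg).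
pose q := Num.min 1 e; have q0 : 0 < q by rewrite lt_min ltr01 e0.
have [q1 qe] : q <= 1 /\ q <= e by rewrite !ge_min !lexx orbT.
(* Conjugation by [B] costs a factor [M ^+ 2], so [s *: f - 1] has norm at most q / 19; the other
   factor of f^2 - 1 has norm at most 18, which leaves less than [e]. *)
exists (q / (38 * M ^+ 2)); first by rewrite divr_gt0 // mulr_gt0 // exprn_gt0 //; lra.
set r := q / _; have rM : M ^+ 2 * (2 * r) = q / 19.
  by rewrite /r; field; rewrite lt0r_neq0 //; lra.
have r1 : r <= 1.
  rewrite ler_pdivrMr ?mul1r; last by rewrite mulr_gt0 // exprn_gt0 //; lra.
  by nra.
move=> A g dA Gg hr; have dg := fuchsian_det Gg.
have [k Gk nk] := hM A dA; have dk := fuchsian_det Gk.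
have uA := det1_unit dA; have uk := det1_unit dk; have ug := det1_unit dg.
set h := A^-1 * g * A in hr; have dh : \det h = 1 by rewrite !det1M ?det1V.
(* Moving the frame into the bounded region replaces [g] by a conjugate [f] in the group, which the
   bounded matrix [B] conjugates to [h]. *)
pose B := k * A; have dB : \det B = 1 by rewrite det1M.
have uB := det1_unit dB.
pose f := B * h * B^-1.
have fE : f = k * g * k^-1.
  by rewrite /f /h /B invrM // !mulrA !(mulrK uA).
have Gf : fuchsian_set G f.
  rewrite fE; apply: fuchsianM; last exact: fuchsianV.
  exact: fuchsianM.
have df := fuchsian_det Gf; have uf := det1_unit df.
suff f1 : f = 1 \/ f = -1.
  have -> : g = k^-1 * f * k by rewrite fE !mulrA mulVr // mul1r mulrVK.
  by case: f1 => ->; [left|right]; rewrite ?mulrN1 ?mulr1 ?mulNr mulVr.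
have trf : \tr f = \tr h.
  rewrite -[RHS](tr_conj (A := B^-1)) ?det1V // invrK //.
have [t2|t2] := ltP `|\tr f| 2.
  have [z hz] := elliptic_fixpoint df t2; exact: (fuchsian_free Gf hz).
have [s sE hs] : exists2 s : R, s = 1 \/ s = -1 & 2 <= \tr (s *: h).
  rewrite trf in t2; case: (ler0P (\tr h)) t2 => _ t2.
    by exists (-1); [right|rewrite mxtraceZ mulN1r].
  by exists 1; [left|rewrite mxtraceZ mul1r].
have nB : nf B <= M := nk.
have ffE : f * f = (s *: f) * (s *: f).
  by rewrite -scalerAl -scalerAr scalerA; case: sE => ->; rewrite ?mulrNN mulr1 scale1r.
have nsh : nf (s *: h - 1) <= 2 * r.
  apply: nf_sub1_le => //.
    by case: sE => ->; rewrite ?scaleN1r ?scale1r ?det2N.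
  by case: sE => ->; rewrite ?scaleN1r ?scale1r ?nfN.
have nsf : nf (s *: f - 1) <= q / 19.
  have -> : s *: f - 1 = B * (s *: h - 1) * B^-1.
    by rewrite mulrBr mulrBl mulr1 divrr // -scalerAr -scalerAl.
  apply: le_trans (nfM_le _ _) _; apply: le_trans (ler_wpM2r (nf_ge0 _) (nfM_le _ _)) _.
  rewrite nfV // -rM; have b0 := nf_ge0 B; have h0 := nf_ge0 (s *: h - 1).
  rewrite mulrAC -expr2; apply: ler_pM => //; rewrite ?sqr_ge0 //.
  by rewrite lerXn2r // nnegrE //; lra.
apply: mul_self_eq1 => //; apply: he; first exact: fuchsianM.
rewrite ffE; set v := s *: f in nsf *.
have -> : v * v - 1 = (v - 1) * ((v - 1) + 2%:R).
  have -> : v - 1 + 2%:R = v + 1 by rewrite mulr2n addrA subrK.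
  by rewrite mulrDr mulr1 mulrBl mul1r addrA subrK.
have n0 := nf_ge0 (v - 1).
have n2 : nf (v - 1 + 2%:R) <= 18.
  apply: le_trans (nfD_le _ _) _.
  rewrite (_ : 2%:R = mx2 2 0 0 2); last first.
    by rewrite -[2%:R]/(1 + 1) mx2_1; apply: matrix2P; rewrite mxE !mx2E ?addr0.
  by rewrite nf_mx2; lra.
apply: le_lt_trans (nfM_le _ _) _.
by apply: le_lt_trans (ler_wpM2l n0 n2) _; lra.
Qed.

Lemma injectivity_radius : cocompact G -> exists2 r : R, 0 < r &
  forall g A, fuchsian_set G g -> \det A = 1 ->
  hdist (pt A) (pt (g * A)) < r -> g = 1 \/ g = -1.
Proof.
move=> /injectivity_nf[r r0 hr]; exists (arcosh (1 + r / 2)).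
  by rewrite -(_ : arcosh 1 = 0 :> R) ?arcosh_lt ?ltrDl ?divr_gt0 // /arcosh expr1n subrr sqrtr0 addr0 ln1.
move=> g A Gg dA; have dg := fuchsian_det Gg.
have r1 : 1 <= 1 + r / 2 by rewrite lerDl divr_ge0 // ltW.
rewrite hdist_lt ?arcosh_ge0 // arcoshK // chd_pt ?det1M // => h.
by apply: hr dA Gg _; rewrite -mulrA; lra.
Qed.

Lemma hdistC z w : hdist z w = hdist w z.
Proof. by rewrite !hdistE chdC. Qed.

Lemma hdist_geo A s t : \det A = 1 ->
  hdist (pt (A * geo s)) (pt (A * geo t)) = `|s - t|.
Proof. by move=> dA; rewrite hdistE chd_geo // -cosh_norm coshK // distrC. Qed.

Lemma sdist_le z w : sdist (\pi_X z) (\pi_X w) <= hdist z w.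
Proof.
apply: ge_inf; last by exists z, w.
by exists 0 => _ [a [b [_ _ ->]]]; exact: hdist_ge0.
Qed.

(** Some pair of representatives comes close enough to the infimum; a group element moves its first
    point to [pt A]. *)
Lemma sdist_lift A (p : X) : \det A = 1 -> forall e, sdist (\pi_X (pt A)) p < e ->
  exists B, [/\ \det B = 1, \pi_X (pt B) = p & hdist (pt A) (pt B) < e].
Proof.
move=> dA e; have [C dC ep] := pi_surj p => h.
have [|_ [z [w [ez ew ->]]] hzw] := @inf_lt _ _ _ _ h.
  by exists (hdist (pt A) (pt C)), (pt A), (pt C).
have [Z dZ eZ] := pt_surj z; have [W dW eW] := pt_surj w.
move: ez hzw; rewrite eZ eW => /(pi_pt G dZ dA)[g Gg ->]; have dg := fuchsian_det Gg.
exists (g * W); rewrite det1M // pi_ptM // -eW; split=> //.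
by rewrite hdistE chd_ptM // -hdistE.
Qed.

Section Radius.
Variable r : R.
Hypothesis inj : forall g A, fuchsian_set G g -> \det A = 1 ->
  hdist (pt A) (pt (g * A)) < r -> g = 1 \/ g = -1.

(** A closer pair of representatives would yield a group element moving [pt B] by less than [r]; it
    is then 1 or -1, fixes the point, and nothing was gained. *)
Lemma sdist_local z w : hdist z w < r / 2 ->
  sdist (\pi_X z) (\pi_X w) = hdist z w.
Proof.
have [A dA ->] := pt_surj z; have [B dB ->] := pt_surj w => h.
apply/eqP; rewrite eq_le sdist_le leNgt; apply/negP => hlt.
have [C [dC /esym/(pi_pt G dB dC)[g Gg ->] hC]] := sdist_lift dA hlt.
have dg := fuchsian_det Gg.
have : hdist (pt B) (pt (g * B)) < r.
  apply: le_lt_trans (hdist_triangle (pt A) _ _) _.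
  by rewrite (hdistC (pt B)); lra.
move=> /(inj Gg dB) [] eg; move: hC; rewrite eg.
  by rewrite mul1r ltxx.
by rewrite mulN1r ptN // ltxx.
Qed.

Lemma local_geodesic_pt A : 0 < r -> \det A = 1 ->
  local_geodesic [set: R] (fun t => \pi_X (pt (A * geo t))).
Proof.
move=> r0 dA t _; exists (r / 4); first by rewrite divr_gt0.
move=> s s' _ _ hs hs'; have h : `|s - s'| < r / 2.
  have := ler_distD t s s'; rewrite (distrC t s'); lra.
by rewrite sdist_local hdist_geo.
Qed.

End Radius.
End Injectivity.

(** * Lifting geodesics to the half-plane *)

Section Lifting.
Variables (R : realType) (G : fuchsian_group R) (r : R).
Implicit Types (A B g : 'M[R]_2) (z w : half_plane R).
Local Notation X := (surface G).
Hypothesis r0 : 0 < r.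
Hypothesis inj : forall g A, fuchsian_set G g -> \det A = 1 ->
  hdist (pt A) (pt (g * A)) < r -> g = 1 \/ g = -1.

(** Points of the curve near [c t] lift close to one chosen lift of [c t], where the projection is
    isometric. Two lifted points fix a geodesic, and [geo_rigid] puts all the others on it. *)
Lemma local_lift (D : set R) (c : R -> X) t : local_geodesic D c -> D t ->
  exists2 e, 0 < e & exists2 A, \det A = 1 &
    forall s, D s -> `|s - t| < e -> c s = \pi_X (pt (A * geo s)).
Proof.
move=> lg Dt; have [e0 e00 he0] := lg t Dt.
pose e := Num.min e0 (r / 4); have ep : 0 < e by rewrite lt_min e00 divr_gt0.
have [ee0 er] : e <= e0 /\ e <= r / 4 by rewrite !ge_min !lexx orbT.
have [Z dZ eZ] := pt_surj (repr (c t)).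
have ct : c t = \pi_X (pt Z) by rewrite -eZ reprK.
have lift s : D s -> `|s - t| < e ->
    exists w, \pi_X w = c s /\ hdist (pt Z) w = `|s - t|.
  move=> Ds hs; have e1 : sdist (\pi_X (pt Z)) (c s) = `|s - t|.
    by rewrite -ct distrC; apply: he0 => //; rewrite ?subrr ?normr0 // (lt_le_trans hs).
  have h1 : sdist (\pi_X (pt Z)) (c s) < r / 2 by rewrite e1; lra.
  have [B [dB eB hB]] := sdist_lift dZ h1; exists (pt B); split=> //.
  by rewrite -(sdist_local inj) // eB.
have [[s1 [Ds1 hs1 s1t]]|none] := pselect (exists s1, [/\ D s1, `|s1 - t| < e & s1 != t]).
  have [w1 [ew1 hw1]] := lift _ Ds1 hs1.
  have [A dA [eA ew]] : exists2 A, \det A = 1 & pt Z = pt A /\ w1 = pt (A * geo (s1 - t)).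
    by apply: geo_from; rewrite -cosh_hdist hw1 cosh_norm.
  exists e => //; exists (A * geo (- t)); first by rewrite det1M ?det_geo.
  move=> s Ds hs; have [w [ew' hw]] := lift _ Ds hs.
  rewrite -ew'; congr (\pi_X _).
  have hww : hdist w1 w = `|s1 - s|.
    have lt2 : hdist w1 w < r / 2.
      apply: le_lt_trans (hdist_triangle (pt Z) _ _) _.
      by rewrite (hdistC w1) hw1 hw; lra.
    rewrite -(sdist_local inj) // ew1 ew'.
    by apply: he0 => //; exact: lt_le_trans ee0.
  have st : t != s1 by rewrite eq_sym.
  apply: (geo_rigid _ st); first by rewrite det1M ?det_geo.
    by rewrite -mulrA -geoD addNr geo0 mulr1 -eA -cosh_hdist hw cosh_norm.
  by rewrite -mulrA -geoD addrC -ew -cosh_hdist hww distrC cosh_norm.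
(* Here [t] is isolated in [D], so any direction at [Z] will do. *)
exists e => //; exists (Z * geo (- t)); first by rewrite det1M ?det_geo.
move=> s Ds hs; have [->|st] := eqVneq s t; last by case: none; exists s.
by rewrite -mulrA -geoD addNr geo0 mulr1.
Qed.

(** An element [g] matches the two lifts at [s1]. The element matching them at a nearby time differs
    from [g] by a small displacement, hence by a sign; so [g * A] and [B] share two points and the
    whole geodesic. *)
Lemma lift_unique A B s0 s1 : \det A = 1 -> \det B = 1 -> s0 < s1 ->
  (forall s, s0 <= s <= s1 -> \pi_X (pt (A * geo s)) = \pi_X (pt (B * geo s))) ->
  forall s, \pi_X (pt (A * geo s)) = \pi_X (pt (B * geo s)).
Proof.
move=> dA dB s01 h.
have dg1 C (s : R) : \det C = 1 -> \det (C * geo s) = 1 by move=> dC; rewrite det1M ?det_geo.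
have /(pi_pt G (dg1 _ _ dA) (dg1 _ _ dB))[g Gg eg] : \pi_X (pt (A * geo s1)) = \pi_X (pt (B * geo s1)).
  by apply: h; rewrite lexx ltW.
have dg := fuchsian_det Gg.
(* Within r / 4 of [s1], so that the displacement to be bounded is at most r / 2. *)
pose s2 := Num.max s0 (s1 - r / 4).
have [s02 s2r] : s0 <= s2 /\ s1 - r / 4 <= s2 by rewrite !le_max !lexx orbT.
have s21 : s2 < s1 by rewrite gt_max s01 gtrBl divr_gt0.
have e2 : pt (g * A * geo s2) = pt (B * geo s2).
  have /(pi_pt G (dg1 _ _ dA) (dg1 _ _ dB))[k Gk ek] :
    \pi_X (pt (A * geo s2)) = \pi_X (pt (B * geo s2)) by apply: h; rewrite s02 ltW.
  have dk := fuchsian_det Gk.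
  have Gq : fuchsian_set G (k * g^-1) by apply: fuchsianM => //; exact: fuchsianV.
  have dgA : \det (g * A * geo s2) = 1 by rewrite dg1 // det1M.
  have qE : k * g^-1 * (g * A * geo s2) = k * (A * geo s2).
    by rewrite !mulrA mulrVK // det1_unit.
  have : hdist (pt (g * A * geo s2)) (pt (k * g^-1 * (g * A * geo s2))) < r.
    rewrite qE -ek; apply: le_lt_trans (hdist_triangle (pt (B * geo s1)) _ _) _.
    rewrite [X in _ + X]hdist_geo // eg -(mulrA g) hdistE chd_ptM ?dg1 // -hdistE hdist_geo //.
    by rewrite distrC gtr0_norm ?subr_gt0 //; lra.
  move=> /(inj Gq dgA) [] e; rewrite ek -qE e; first by rewrite mul1r.
  by rewrite mulN1r ptN.
have e1 : pt (g * A * geo s1) = pt (B * geo s1) by rewrite eg mulrA.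
move=> s; rewrite -(geo_unique _ dB (negbT (lt_eqF s21)) e2 e1) ?det1M //.
by rewrite -mulrA (pi_ptM Gg) ?dg1.
Qed.

(** Continuation: at the supremum of the times reached by a lift, a local lift overlaps an earlier
    one and is glued to it by [lift_unique], which pushes the supremum to the full length. *)
Lemma segment_lift (c : geodesic_segment G) : exists2 A, \det A = 1 &
  forall s, 0 <= s <= seg_length c -> seg_map c s = \pi_X (pt (A * geo s)).
Proof.
set L := seg_length c; have L0 : 0 <= L := seg_length_ge0 c.
pose S : set R := [set t : R | 0 <= t <= L /\ exists2 A, \det A = 1 &
  forall s : R, 0 <= s <= t -> seg_map c s = \pi_X (pt (A * geo s))].
have lift (t : R) : 0 <= t <= L -> exists2 e, 0 < e & exists2 A, \det A = 1 &
    forall s, 0 <= s <= L -> `|s - t| < e -> seg_map c s = \pi_X (pt (A * geo s)).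
  move=> ht; have [|e e0 [A dA hA]] := local_lift (@seg_geodesic _ _ c) (t := t).
    by rewrite /= in_itv.
  by exists e => //; exists A => // s hs; apply: hA; rewrite /= in_itv.
have S0 : S 0.
  have [|e e0 [A dA hA]] := lift 0; first by rewrite lexx.
  split; first by rewrite lexx.
  exists A => // s hs; have -> : s = 0 by apply/eqP; rewrite eq_le andbC.
  by apply: hA; rewrite ?lexx ?subrr ?normr0.
have ubS : ubound S L by move=> t [/andP[]].
have hS : has_ubound S by exists L.
have sup0 : 0 <= sup S by apply: ub_le_sup.
have supL : sup S <= L by apply: ge_sup => //; exists 0.
have [|e e0 [B dB hB]] := lift (sup S); first by rewrite sup0.
have [t1 [/andP[t10 t1L] [A dA hA]] ht1] : exists2 t1, S t1 & sup S - e < t1.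
  by apply: sup_gt; [exists 0|rewrite gtrBl].
have t1S : t1 <= sup S by apply: ub_le_sup => //; split; [rewrite t10|exists A].
pose t2 := Num.min L (sup S + e / 2).
have [t2L t2e] : t2 <= L /\ t2 <= sup S + e / 2 by rewrite !ge_min !lexx orbT.
have t2S : sup S <= t2 by rewrite le_min supL lerDl divr_ge0 // ltW.
have hB' s : 0 <= s <= t2 -> sup S - e < s -> seg_map c s = \pi_X (pt (B * geo s)).
  move=> /andP[s0 s2] hs; apply: hB; first by rewrite s0 (le_trans s2).
  by rewrite ltr_norml; apply/andP; split; lra.
have St2 : S t2.
  split; first by rewrite t2L (le_trans sup0).
  exists B => // s /andP[s0 s2].
  have [hs|hs] := ltP (sup S - e) s; first by apply: hB' => //; rewrite s0.
  rewrite hA ?s0 /=; last by lra.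
  (* On the interval from [u] to [t1] both lifts are defined; agreement there propagates to all
     times, in particular back to [s]. *)
  pose u := Num.max 0 (Num.max s ((sup S - e + t1) / 2)).
  have [u1 u2 u3] : [/\ 0 <= u, s <= u & (sup S - e + t1) / 2 <= u].
    by rewrite !le_max !lexx !orbT.
  have ut : u < t1 by rewrite !gt_max; apply/and3P; split; lra.
  apply: (lift_unique dA dB ut) => v /andP[v1 v2].
  rewrite -hA ?v2 ?(le_trans u1) // hB' //; last by lra.
  by apply/andP; split; lra.
have : t2 <= sup S by apply: ub_le_sup.
rewrite ge_min; case/orP => [Ls|]; last by rewrite gerDl; lra.
by have [_] := St2; rewrite /t2 min_l //; lra.
Qed.

End Lifting.

(** * Connecting group elements *)

Section Connecting.
Variables (R : realType) (G : fuchsian_group R).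
Implicit Types (A B g h W : 'M[R]_2).
Hypothesis coc : cocompact G.

Lemma conj_scalar A g : \det A = 1 -> g = 1 \/ g = -1 ->
  A^-1 * g * A = 1 \/ A^-1 * g * A = -1.
Proof.
move=> dA [] ->; [left|right]; rewrite ?mulr1 ?mulrN1 ?mulNr mulVr //; exact: det1_unit.
Qed.

(* A parabolic element moves points high up in its cusp arbitrarily little. *)
Lemma no_parabolic A g s m : \det A = 1 -> fuchsian_set G g -> s ^+ 2 = 1 ->
  A^-1 * g * A = mx2 s m 0 s \/ A^-1 * g * A = mx2 s 0 m s -> m = 0.
Proof.
move=> dA Gg s1 e; have [r r0 hr] := injectivity_nf coc.
(* Far enough up the cusp that m^2 e^(-2t) < r. *)
pose t := ln (1 + m ^+ 2 / r).
have q0 : 0 <= m ^+ 2 / r by rewrite divr_ge0 ?sqr_ge0 // ltW.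
have et : expR t = 1 + m ^+ 2 / r by rewrite lnK // posrE; lra.
have small : 2 + m ^+ 2 * expR (- t) ^+ 2 < 2 + r.
  rewrite ltrD2l expRN et exprVn ltr_pdivrMr ?exprn_gt0 //; last by lra.
  have : m ^+ 2 = r * (m ^+ 2 / r) by field; rewrite lt0r_neq0.
  by move: q0; move: (m ^+ 2 / r) => q q0 ->; rewrite ltr_pM2l //; nra.
have conjE u : (A * geo u)^-1 * g * (A * geo u) = geo (- u) * (A^-1 * g * A) * geo u.
  by rewrite invrM ?det1_unit ?det_geo // geoV !mulrA.
have nfE (u : R) x y : nf (mx2 (expR (- (u / 2))) 0 0 (expR (u / 2)) * mx2 s x y s *
    mx2 (expR (u / 2)) 0 0 (expR (- (u / 2)))) =
    2 + x ^+ 2 * expR (- u) ^+ 2 + y ^+ 2 * expR u ^+ 2.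
  have e2 (v : R) : expR v = expR (v / 2) ^+ 2 by rewrite expr2 -expRD; congr expR; field.
  have := expRxMexpNx_1 (u / 2); rewrite (e2 u) (e2 (- u)) mulNr.
  move: (expR (u / 2)) (expR (- (u / 2))) => E F EF; rewrite !mx2M nf_mx2.
  transitivity ((E * F) ^+ 2 * s ^+ 2 *+ 2 + x ^+ 2 * F ^+ 2 ^+ 2 + y ^+ 2 * E ^+ 2 ^+ 2).
    by ring.
  by rewrite EF s1; ring.
have finish : g = 1 \/ g = -1 -> m = 0.
  move=> /(conj_scalar dA); case: e => ->; rewrite mx2_1 ?mx2N.
    by case=> /matrixP/(_ 0 1); rewrite !mx2E // oppr0.
  by case=> /matrixP/(_ 1 0); rewrite !mx2E // oppr0.
case: e => e.
- have dB : \det (A * geo t) = 1 by rewrite det1M ?det_geo.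
  apply: finish; apply: (hr _ g dB Gg); rewrite conjE e /geo mulNr opprK nfE.
  by rewrite expr0n /= mul0r addr0.
- have dB : \det (A * geo (- t)) = 1 by rewrite det1M ?det_geo.
  apply: finish; apply: (hr _ g dB Gg); rewrite conjE e opprK.
  have := nfE (- t) 0 m; rewrite !mulNr !opprK /geo mulNr opprK => ->.
  by rewrite expr0n /= mul0r addr0.
Qed.

(** The trace bound makes the eigenvalues real; the first column of [A] is an eigenvector, (l - d,
    c) when c is nonzero. *)
Lemma triangularize g : \det g = 1 -> 2 <= `|\tr g| ->
  exists2 A, \det A = 1 & exists l m, A^-1 * g * A = mx2 l m 0 l^-1 /\ l != 0.
Proof.
have [a [b [c [d ->]]]] := mx2P g; rewrite det_mx2 tr_mx2 => h t2.
have [c0|c0] := eqVneq c 0.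
  exists 1; first exact: det1.
  have a0 : a != 0.
    by apply/eqP => a0; move: h => /eqP; rewrite a0 c0 mul0r mulr0 subr0 eq_sym oner_eq0.
  exists a, b; rewrite invr1 mul1r mulr1 c0; split=> //; congr mx2.
  by apply: (mulfI a0); rewrite divff // -h c0 mulr0 subr0.
have tt : 0 <= (a + d) ^+ 2 - 4.
  by rewrite -(real_normK (num_real (a + d))); have := normr_ge0 (a + d); nra.
pose l := (a + d + Num.sqrt ((a + d) ^+ 2 - 4)) / 2.
have lE : l * (a + d - l) = 1.
  by rewrite /l; have := sqr_sqrtr tt; move: (Num.sqrt _) => x xE; field: xE.
have l0 : l != 0.
  by apply/eqP => l0; move: lE => /eqP; rewrite l0 mul0r eq_sym oner_eq0.
have dA : (l - d) * 0 - (- c^-1) * c = 1 by field.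
exists (mx2 (l - d) (- c^-1) c 0); first by rewrite det_mx2.
exists l, (- c^-1); split=> //; rewrite mx2V // !mx2M.
have bE : b = (a * d - 1) / c by rewrite -h; field.
have lV : l^-1 = a + d - l by apply: (mulfI l0); rewrite divff.
have l2 : l ^+ 2 = (a + d) * l - 1 by move: lE; lra.
by rewrite lV; congr mx2; rewrite bE; field: l2.
Qed.

(** Otherwise the group would preserve a geodesic, and could not bring points far away from it back
    to a bounded set. *)
Lemma not_all_diagonal A : \det A = 1 ->
  exists2 g, fuchsian_set G g &
    (A^-1 * g * A) 0 1 != 0 \/ (A^-1 * g * A) 1 0 != 0.
Proof.
move=> dA; apply: contrapT => none.
have diag g : fuchsian_set G g -> (A^-1 * g * A) 0 1 = 0 /\ (A^-1 * g * A) 1 0 = 0.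
  move=> Gg; split; apply/eqP; apply: contrapT => /negP n0; apply: none; exists g => //.
    by left.
  by right.
(* For diagonal entries with a d = 1, the norm is at least (a x)^2 + d^2 >= 2 x, which exceeds the
   bound [nf A * M]. *)
have [M hM] := coc; pose x := nf A * M + 1.
have du : \det (mx2 1 x 0 1) = 1 by rewrite det_mx2; ring.
have [g Gg hg] := hM (A * mx2 1 x 0 1) (det1M dA du).
have dg := fuchsian_det Gg; have [b0 c0] := diag g Gg.
have dD : \det (A^-1 * g * A) = 1 by rewrite !det1M ?det1V.
have hn : nf (A^-1 * g * A * mx2 1 x 0 1) <= nf A * M.
  have -> : A^-1 * g * A * mx2 1 x 0 1 = A^-1 * (g * (A * mx2 1 x 0 1)) by rewrite !mulrA.
  apply: le_trans (nfM_le _ _) _; rewrite nfV //.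
  by rewrite ler_wpM2l ?nf_ge0.
move: dD hn b0 c0; have [a [b [c [d ->]]]] := mx2P (A^-1 * g * A).
rewrite det_mx2 mx2M !mx2E nf_mx2 => h + b0 c0; rewrite b0 c0 => hn.
have ad : a * d = 1 by move: h; rewrite b0; lra.
have : 0 <= (a * x - d) ^+ 2 by exact: sqr_ge0.
have xE : nf A * M = x - 1 by rewrite /x; ring.
have x1 : 0 < x.
  rewrite /x; have := nf_ge0 A; have := nf_ge0 (g * (A * mx2 1 x 0 1)) => n1 n2.
  have M0 : 0 <= M := le_trans n1 hg.
  by have := mulr_ge0 n2 M0; lra.
have e2 : a * x * d = x by rewrite mulrAC ad mul1r.
rewrite xE in hn; have := sqr_ge0 a; move: hn e2; nra.
Qed.

(** A non-scalar element is not elliptic by freeness and not parabolic by compactness, so it can be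
    diagonalized with l different from 1 and -1. If a second, non-diagonal element shared one fixed
    point with it, their commutator would be parabolic. *)
Lemma exists_hyperbolic_pair : exists A g h l a b c d,
  [/\ \det A = 1, fuchsian_set G g, fuchsian_set G h &
   [/\ A^-1 * g * A = mx2 l 0 0 l^-1, A^-1 * h * A = mx2 a b c d,
       l != 0, l - l^-1 != 0 & b != 0 /\ c != 0]].
Proof.
have [g Gg g1] := not_all_diagonal (det1 _ _).
have dg := fuchsian_det Gg.
have gn1 : ~ (g = 1 \/ g = -1).
  move=> /(conj_scalar (det1 _ _)) [] e; move: g1; rewrite e mx2_1 ?mx2N !mx2E ?oppr0;
  by rewrite eqxx; case.
have [t2|t2] := ltP `|\tr g| 2.
  by have [z hz] := elliptic_fixpoint dg t2; case: gn1; exact: (fuchsian_free Gg hz).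
have [A dA [l [m [e l0]]]] := triangularize dg t2.
have w0 : l - l^-1 != 0.
  apply/eqP => w0; have lV : l^-1 = l by apply/esym/eqP; rewrite -subr_eq0 w0.
  have l2 : l ^+ 2 = 1 by rewrite expr2 -{2}lV divff.
  rewrite lV in e; have m0 := no_parabolic dA Gg l2 (or_introl e).
  apply: gn1; have -> : g = A * (A^-1 * g * A) * A^-1.
    by rewrite !mulrA divrr ?det1_unit // mul1r mulrK // det1_unit.
  move: l2 => /eqP; rewrite sqrf_eq1 e m0 => /orP[] /eqP ->; [left|right].
    by rewrite -mx2_1 mulr1 divrr // det1_unit.
  have -> : mx2 (-1) 0 0 (-1) = -1 :> 'M[R]_2 by rewrite mx2_1 mx2N oppr0.
  by rewrite mulrN1 mulNr divrr // det1_unit.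
have l21 : l ^+ 2 - 1 != 0.
  apply: contraNneq w0 => l2; apply/eqP; transitivity ((l ^+ 2 - 1) / l); first by field.
  by rewrite l2 mul0r.
(* This shear removes the off-diagonal entry [m]. *)
pose x := - m / (l - l^-1); pose u := mx2 1 x 0 1.
have hu : 1 * 1 - x * 0 = 1 by ring.
have du : \det u = 1 by rewrite det_mx2.
have dAu : \det (A * u) = 1 by rewrite det1M.
have eg : (A * u)^-1 * g * (A * u) = mx2 l 0 0 l^-1.
  rewrite invrM ?det1_unit // !mulrA -2!(mulrA u^-1) e /u mx2V // !mx2M.
  by congr mx2; rewrite /x; field; rewrite ?l0 // -expr2 l21.
have [h Gh bc] := not_all_diagonal dAu.
have dh := fuchsian_det Gh.
have [a [b [c [d eh]]]] := mx2P ((A * u)^-1 * h * (A * u)).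
have dd : a * d - b * c = 1 by rewrite -det_mx2 -eh !det1M ?det1V.
(* When [h] is triangular in this frame, its commutator with the diagonal [g] is unipotent, which
   [no_parabolic] forces to be trivial. *)
have Gk : fuchsian_set G (g * h * g^-1 * h^-1).
  apply: fuchsianM; last exact: fuchsianV.
  by apply: fuchsianM; [exact: fuchsianM|exact: fuchsianV].
have ek : (A * u)^-1 * (g * h * g^-1 * h^-1) * (A * u) =
    mx2 l 0 0 l^-1 * mx2 a b c d * mx2 l^-1 0 0 l * mx2 d (- b) (- c) a.
  have -> : mx2 l^-1 0 0 l = (mx2 l 0 0 l^-1)^-1.
    by rewrite mx2V ?oppr0 // divff // mulr0 subr0.
  rewrite -(mx2V dd) -eg -eh; move: (A * u) dAu => B dB.
  have uB := det1_unit dB.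
  have cV k : \det k = 1 -> (B^-1 * k * B)^-1 = B^-1 * k^-1 * B.
    by move=> dk; rewrite !invrM ?det1_unit ?det1M ?det1V // invrK mulrA.
  by rewrite !cV // !mulrA !(mulrK uB).
rewrite eh !mx2E in bc.
exists (A * u), g, h, l, a, b, c, d; split=> //; split=> //; split.
- apply/eqP => b0; move: bc; rewrite b0 eqxx; case=> // c0.
  have ad : a * d = 1 by move: dd; rewrite b0; lra.
  have : d * c * ((l ^+ 2)^-1 - 1) = 0.
    apply: (no_parabolic dAu Gk (expr1n _ 2)); right; rewrite ek b0 !mx2M.
    by congr mx2; field: ad.
  move=> /eqP; rewrite !mulf_eq0 (negPf c0) orbF => /orP[/eqP d0|/eqP e0].
    by move: ad => /eqP; rewrite d0 mulr0 eq_sym oner_eq0.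
  case/eqP: l21; transitivity (- l ^+ 2 * ((l ^+ 2)^-1 - 1)); first by field.
  by rewrite e0 mulr0.
- apply/eqP => c0; move: bc; rewrite c0 eqxx; case=> // b0.
  have ad : a * d = 1 by move: dd; rewrite c0; lra.
  have : a * b * (l ^+ 2 - 1) = 0.
    apply: (no_parabolic dAu Gk (expr1n _ 2)); left; rewrite ek c0 !mx2M.
    by congr mx2; field: ad.
  move=> /eqP; rewrite !mulf_eq0 (negPf b0) (negPf l21) !orbF => /eqP a0.
  by move: ad => /eqP; rewrite a0 mul0r eq_sym oner_eq0.
Qed.

End Connecting.

(** * Four functionals controlling a matrix *)

Section Filling.
Variable R : realType.
Implicit Types (A B W : 'M[R]_2) (N f : 'M[R]_2 -> R).

(** Stable under linear combinations, so the entries of W can be recovered from the four functionals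
    without tracking constants. *)
Definition dominated N f := exists2 K, 0 <= K & forall W, `|f W| <= K * N W.

Lemma dominatedD N f1 f2 : dominated N f1 -> dominated N f2 ->
  dominated N (fun W => f1 W + f2 W).
Proof.
move=> [K K0 hK] [L L0 hL]; exists (K + L); first exact: addr_ge0.
by move=> W; rewrite mulrDl (le_trans (ler_normD _ _)) // lerD.
Qed.

Lemma dominatedZ N f k : dominated N f -> dominated N (fun W => k * f W).
Proof.
move=> [K K0 hK]; exists (`|k| * K); first exact: mulr_ge0.
by move=> W; rewrite normrM -mulrA ler_wpM2l.
Qed.

Lemma dominated_eq N f1 f2 : f1 =1 f2 -> dominated N f1 -> dominated N f2.
Proof. by move=> e [K K0 hK]; exists K => // W; rewrite -e. Qed.

(* With E = (a b; c d), the four functionals are W |-> sum_ij W_ij k_ij for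
   k = 1, D, E, DE where D = diag(l, 1/l): they form a basis. *)
Definition four_norm (l a b c d : R) W :=
  `|W 0 0 + W 1 1| + `|l * W 0 0 + l^-1 * W 1 1| +
  `|a * W 0 0 + b * W 0 1 + c * W 1 0 + d * W 1 1| +
  `|l * (a * W 0 0 + b * W 0 1) + l^-1 * (c * W 1 0 + d * W 1 1)|.

Lemma four_norm_ge0 l a b c d W : 0 <= four_norm l a b c d W.
Proof. by rewrite !addr_ge0. Qed.

(** The first two functionals determine the diagonal of W because l differs from 1/l; once it is
    subtracted, the other two determine the off-diagonal entries because b and c are nonzero. *)
Lemma nf_four_norm l a b c d : l != 0 -> l - l^-1 != 0 -> b != 0 -> c != 0 ->
  exists2 K, 0 <= K & forall W, nf W <= K * four_norm l a b c d W ^+ 2.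
Proof.
move=> l0 w0 b0 c0; set N := four_norm l a b c d.
pose e1 W := W 0 0 + W 1 1; pose e2 W := l * W 0 0 + l^-1 * W 1 1.
pose e3 W := a * W 0 0 + b * W 0 1 + c * W 1 0 + d * W 1 1.
pose e4 W := l * (a * W 0 0 + b * W 0 1) + l^-1 * (c * W 1 0 + d * W 1 1).
have [d1 d2 d3 d4] : [/\ dominated N e1, dominated N e2, dominated N e3 & dominated N e4].
  have NE W : N W = `|e1 W| + `|e2 W| + `|e3 W| + `|e4 W| by [].
  by split; exists 1 => // W; rewrite mul1r NE; have := normr_ge0 (e1 W);
    have := normr_ge0 (e2 W); have := normr_ge0 (e3 W); have := normr_ge0 (e4 W); lra.
pose w := l - l^-1; rewrite -/w in w0.
have ll : l * l - 1 != 0.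
  apply: contraNneq w0 => l2; apply/eqP; transitivity ((l * l - 1) / l); first by rewrite /w; field.
  by rewrite l2 mul0r.
have D00 : dominated N (fun W => W 0 0).
  apply: dominated_eq (dominatedD (dominatedZ w^-1 d2) (dominatedZ (- (w * l)^-1) d1)).
  by move=> W; rewrite /e1 /e2 /w; field; rewrite l0 ll.
have D11 : dominated N (fun W => W 1 1).
  apply: dominated_eq (dominatedD d1 (dominatedZ (-1) D00)).
  by move=> W; rewrite /e1; ring.
have DX : dominated N (fun W => b * W 0 1 + c * W 1 0).
  apply: dominated_eq (dominatedD d3 (dominatedD (dominatedZ (- a) D00) (dominatedZ (- d) D11))).
  by move=> W; rewrite /e3; ring.
have DY : dominated N (fun W => l * (b * W 0 1) + l^-1 * (c * W 1 0)).
  apply: dominated_eq (dominatedD d4 (dominatedD (dominatedZ (- (l * a)) D00) (dominatedZ (- (l^-1 * d)) D11))).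
  by move=> W; rewrite /e4; ring.
have D01 : dominated N (fun W => W 0 1).
  apply: dominated_eq (dominatedD (dominatedZ (w * b)^-1 DY) (dominatedZ (- (w * b * l)^-1) DX)).
  by move=> W; rewrite /w; field; rewrite l0 b0 ll.
have D10 : dominated N (fun W => W 1 0).
  apply: dominated_eq (dominatedD (dominatedZ c^-1 DX) (dominatedZ (- (b / c)) D01)).
  by move=> W; field.
have sq f : dominated N f -> exists2 K, 0 <= K & forall W, f W ^+ 2 <= K * N W ^+ 2.
  move=> [K K0 hK]; exists (K ^+ 2); first exact: sqr_ge0.
  move=> W; rewrite -exprMn -(real_normK (num_real (f W))) lerXn2r ?nnegrE //.
  by rewrite mulr_ge0 // four_norm_ge0.
have [K1 K10 h1] := sq _ D00; have [K2 K20 h2] := sq _ D01.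
have [K3 K30 h3] := sq _ D10; have [K4 K40 h4] := sq _ D11.
exists (K1 + K2 + K3 + K4); first by rewrite !addr_ge0.
by move=> W; rewrite /nf !mulrDl !lerD.
Qed.

End Filling.

(** * Transversal and positive connecting elements *)

Section Positive.
Variables (R : realType) (G : fuchsian_group R).
Implicit Types (A B g h W : 'M[R]_2).
Hypothesis coc : cocompact G.

(** By Lagrange's identity the squared norms of the two rows have product at least det^2 = 1. *)
Lemma row_norm A i : \det A = 1 -> 1 <= nf A * (A i 0 ^+ 2 + A i 1 ^+ 2).
Proof.
have [a [b [c [d ->]]]] := mx2P A; rewrite det_mx2 nf_mx2 => h.
have key (x y z t : R) : x * t - y * z = 1 ->
    1 <= (x ^+ 2 + y ^+ 2 + z ^+ 2 + t ^+ 2) * (x ^+ 2 + y ^+ 2).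
  move=> e; have : 1 <= (z ^+ 2 + t ^+ 2) * (x ^+ 2 + y ^+ 2).
    rewrite -[leLHS](expr1n _ 2) -e -subr_ge0.
    by rewrite [leRHS](_ : _ = (x * z + y * t) ^+ 2) ?sqr_ge0 //; ring.
  by have := sqr_ge0 (x ^+ 2 + y ^+ 2); lra.
apply: (ord2P (P := fun i => _ <= _ * (mx2 a b c d i 0 ^+ 2 + mx2 a b c d i 1 ^+ 2))) i;
  rewrite !mx2E; first exact: key.
have := key d (- c) (- b) a; rewrite !sqrrN => k.
suff : 1 <= (d ^+ 2 + c ^+ 2 + b ^+ 2 + a ^+ 2) * (d ^+ 2 + c ^+ 2) by lra.
by apply: k; lra.
Qed.

(** The upper right entry of U k V pairs k with a rank-one matrix W made of a row of U and a column
    of V. If it were small for 1, g, h and gh, then W would be small, although its row and column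
    are bounded below. *)
Lemma exists_transversal (M : R) : exists d N : R, 0 < d /\
  forall A B, \det A = 1 -> \det B = 1 -> nf A <= M -> nf B <= M ->
  exists2 g, fuchsian_set G g & nf (A^-1 * g * B) <= N /\ d <= `|(A^-1 * g * B) 0 1|.
Proof.
have [C [g [h [l [a [b [c [d [dC Gg Gh [eg eh l0 w0 [b0 c0]]]]]]]]]]] :=
  exists_hyperbolic_pair coc.
have dg := fuchsian_det Gg; have dh := fuchsian_det Gh.
have [K K0 hK] := nf_four_norm a d l0 w0 b0 c0.
pose Q := nf (1 : 'M[R]_2) + nf g + nf h + nf (g * h).
have C2 := nf_ge2 dC.
(* The choice 4 e (K + 1) (P + 1) = 1 gives P^2 K (4 e)^2 < 1, against 1 <= P^2 nf W. *)
pose P := `|M| * nf C; pose e := (4 * (K + 1) * (P + 1))^-1.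
have P0 : 0 <= P by rewrite mulr_ge0 // nf_ge0.
have e0 : 0 < e by rewrite invr_gt0 !mulr_gt0 //; lra.
exists e, (M * Q * M); split=> // A B dA dB nA nB.
have M2 : 2 <= M := le_trans (nf_ge2 dA) nA.
have PE : P = M * nf C by rewrite /P ger0_norm //; lra.
have uC := det1_unit dC.
have nfQ k : nf k <= Q -> nf (A^-1 * k * B) <= M * Q * M.
  move=> hk; apply: le_trans (nfM_le _ _) _; apply: ler_pM; rewrite ?nf_ge0 //.
  by apply: le_trans (nfM_le _ _) _; rewrite nfV // ler_pM ?nf_ge0.
have [Q1 Q2 Q3 Q4] : [/\ nf (1 : 'M[R]_2) <= Q, nf g <= Q, nf h <= Q & nf (g * h) <= Q].
  have := nf_ge0 (1 : 'M[R]_2); have := nf_ge0 g; have := nf_ge0 h; have := nf_ge0 (g * h).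
  by rewrite /Q; split; lra.
apply: contrapT => none.
have small k : fuchsian_set G k -> nf k <= Q -> `|(A^-1 * k * B) 0 1| < e.
  move=> Gk hk; rewrite ltNge; apply/negP => h1; apply: none.
  by exists k => //; split=> //; exact: nfQ.
pose U := A^-1 * C; pose V := C^-1 * B.
have dU : \det U = 1 by rewrite det1M ?det1V.
have dV : \det V = 1 by rewrite det1M ?det1V.
have kE k : A^-1 * k * B = U * (C^-1 * k * C) * V.
  by rewrite /U /V !mulrA !(mulrK uC).
pose W := mx2 (U 0 0 * V 0 1) (U 0 0 * V 1 1) (U 0 1 * V 0 1) (U 0 1 * V 1 1).
have hW : four_norm l a b c d W < 4 * e.
  have := small _ (fuchsian1 G) Q1; have := small _ Gg Q2.
  have := small _ Gh Q3; have := small _ (fuchsianM Gg Gh) Q4.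
  rewrite !kE mulr1 mulVr // mulr1.
  have -> : C^-1 * (g * h) * C = (C^-1 * g * C) * (C^-1 * h * C).
    by rewrite !mulrA mulrK.
  rewrite eg eh /four_norm /W mx2M !mulmx2E !mx2E.
  rewrite !(mulr0, mul0r, addr0, add0r) => h1 h2 h3 h4.
  rewrite (_ : 4 * e = e + e + e + e); last by ring.
  rewrite !ltrD //.
  - by apply: le_lt_trans h3; rewrite le_eqVlt; apply/orP; left; apply/eqP; congr `|_|; ring.
  - by apply: le_lt_trans h2; rewrite le_eqVlt; apply/orP; left; apply/eqP; congr `|_|; ring.
  - by apply: le_lt_trans h1; rewrite le_eqVlt; apply/orP; left; apply/eqP; congr `|_|; ring.
have nU : nf U <= P.
  by rewrite /U; apply: le_trans (nfM_le _ _) _; rewrite nfV // PE ler_pM ?nf_ge0.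
have nV : nf V^-1 <= P.
  rewrite nfV // /V; apply: le_trans (nfM_le _ _) _; rewrite nfV // PE mulrC.
  by rewrite ler_pM ?nf_ge0.
have rU := row_norm 0 dU; have rV := row_norm 0 (det1V dV).
have VE : V^-1 0 0 ^+ 2 + V^-1 0 1 ^+ 2 = V 0 1 ^+ 2 + V 1 1 ^+ 2.
  move: dV; have [x [y [z [t ->]]]] := mx2P V; rewrite det_mx2 => hV.
  by rewrite mx2V // !mx2E sqrrN addrC.
rewrite VE in rV.
have WE : nf W = (U 0 0 ^+ 2 + U 0 1 ^+ 2) * (V 0 1 ^+ 2 + V 1 1 ^+ 2).
  by rewrite nf_mx2; ring.
have {}rU : 1 <= P * (U 0 0 ^+ 2 + U 0 1 ^+ 2).
  by apply: le_trans rU _; rewrite ler_wpM2r // addr_ge0 ?sqr_ge0.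
have {}rV : 1 <= P * (V 0 1 ^+ 2 + V 1 1 ^+ 2).
  by apply: le_trans rV _; rewrite ler_wpM2r // addr_ge0 ?sqr_ge0.
have W1 : 1 <= P ^+ 2 * nf W.
  by rewrite WE expr2 mulrACA; rewrite -[leLHS]mulr1 ler_pM.
have W2 : nf W <= K * (4 * e) ^+ 2.
  apply: le_trans (hK W) _; rewrite ler_wpM2l //.
  by rewrite lerXn2r ?nnegrE ?four_norm_ge0 ?(ltW hW) // mulr_ge0 // ltW.
have eE : (4 * e) ^+ 2 * ((K + 1) * (P + 1)) ^+ 2 = 1.
  rewrite -exprMn (_ : _ * _ = 1) ?expr1n // /e; field.
  by rewrite !lt0r_neq0 // ltr_wpDl.
have : P ^+ 2 * (K * (4 * e) ^+ 2) < 1.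
  have PP : P ^+ 2 < (P + 1) ^+ 2 by nra.
  have KK : K < (K + 1) ^+ 2 by nra.
  have KP : K * P ^+ 2 < (K + 1) ^+ 2 * (P + 1) ^+ 2 by apply: ltr_pM; rewrite ?sqr_ge0.
  have e4 : 0 < (4 * e) ^+ 2 by rewrite exprn_gt0 // mulr_gt0.
  by rewrite -[ltRHS]eE [((K + 1) * _) ^+ 2]exprMn mulrCA mulrA [ltRHS]mulrC ltr_pM2r.
rewrite ltNge => /negP; apply; apply: le_trans W1 _.
by rewrite ler_wpM2l // sqr_ge0.
Qed.

(* [P] and [Q] send infinity to 1 and -1.  Follow [A P] and [B Q] for a long time
   T and return to a bounded set by the cocompactness: between them sits a bounded
   matrix [w] with [w 0 1] away from 0, and conjugation by [geo T] makes this entry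
   dominate, so that the product is close to a multiple of the all-ones matrix. *)
Lemma positive_connection : exists M : R, forall A B, \det A = 1 -> \det B = 1 ->
  exists g s, [/\ fuchsian_set G g, s = 1 \/ s = -1 &
    forall i j, 1 <= (s *: (A^-1 * g * B)) i j <= M].
Proof.
have [M0 hM] := coc; have [d [N [d0 hN]]] := exists_transversal M0.
pose o := Num.sqrt N; have o0 : 0 <= o := sqrtr_ge0 N.
(* [E] is e^T. As E d = d + 4 o + 1, the amplified entry beats three terms of size at most [o] by at
   least 1. *)
pose E := 1 + (4 * o + 1) / d.
have Ed : E * d = d + (4 * o + 1) by rewrite /E mulrDl mul1r divfK // lt0r_neq0.
have E1 : 1 <= E by rewrite lerDl divr_ge0 //; lra.
have E0 : 0 <= E := le_trans ler01 E1.
have n12 : `|2^-1 : R| <= 1 by rewrite ger0_norm //; lra.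
have n14 : `|4^-1 : R| <= 1 by rewrite ger0_norm //; lra.
pose T := ln E.
have expT : expR T = E by rewrite lnK // posrE; lra.
exists (E * o + 4 * o) => A B dA dB.
pose P : 'M[R]_2 := mx2 1 (- 2^-1) 1 2^-1; pose Q : 'M[R]_2 := mx2 1 2^-1 (- 1) 2^-1.
have dP : \det P = 1 by rewrite det_mx2; field.
have hQ : 1 * 2^-1 - 2^-1 * (- 1) = 1 :> R by field.
have dQ : \det Q = 1 by rewrite det_mx2.
have dAP : \det (A * P * geo T) = 1 by rewrite !det1M ?det_geo.
have dBQ : \det (B * Q * geo T) = 1 by rewrite !det1M ?det_geo.
have [g1 G1 n1] := hM _ dAP; have [g2 G2 n2] := hM _ dBQ.
have d1 := fuchsian_det G1; have d2 := fuchsian_det G2.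
have [k Gk [nk kd]] := hN _ _ (det1M d1 dAP) (det1M d2 dBQ) n1 n2.
set w := _^-1 * k * _ in nk kd.
exists (g1^-1 * k * g2), (if 0 <= w 0 1 then 1 else -1); split.
- by apply: fuchsianM => //; apply: fuchsianM => //; exact: fuchsianV.
- by case: ifP; [left|right].
have wE : A^-1 * (g1^-1 * k * g2) * B = P * (geo T * w * geo (- T)) * Q^-1.
  rewrite /w; set f1 := g1 * _; set f2 := g2 * (B * Q * geo T).
  have u1 : f1 \is a GRing.unit by rewrite det1_unit // det1M.
  have e1 : A^-1 * g1^-1 = P * geo T * f1^-1.
    apply: (mulIr u1); rewrite mulrVK // /f1 !mulrA mulrVK ?det1_unit //.
    by rewrite mulVr ?mul1r ?det1_unit.
  have e2 : g2 * B = f2 * geo (- T) * Q^-1.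
    rewrite /f2 -geoV !mulrA. rewrite mulrK ?det1_unit ?det_geo //.
    by rewrite mulrK // det1_unit.
  by move: f1 f2 {u1} e1 e2 => f1 f2 e1 e2; rewrite !mulrA e1 -(mulrA _ g2) e2 !mulrA.
have wo i j : `|w i j| <= o.
  by apply: le_trans (nf_entry _ _ _) _; rewrite ler_wsqrtr.
have ex : expR (T / 2) * expR (- (T / 2)) = 1 := expRxMexpNx_1 _.
have ex2 : expR (T / 2) ^+ 2 = E by rewrite -expT expr2 -expRD; congr expR; field.
have ey2 : expR (- (T / 2)) ^+ 2 <= 1.
  by rewrite exprn_ile1 ?expR_ge0 // expR_le1 oppr_le0 divr_ge0 // ln_ge0.
move: wo kd wE; have [w11 [w12 [w21 [w22 ->]]]] := mx2P w; rewrite !mx2E => wo kd ->.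
have := wo 0 0; have := wo 0 1; have := wo 1 0; have := wo 1 1.
rewrite !mx2E /geo mulNr opprK => a22 a21 a12 a11.
move: ex ex2 ey2; set x := expR _; set y := expR _ => ex ex2 ey2.
have aY : `|y ^+ 2 * w21| <= o.
  rewrite normrM ger0_norm ?sqr_ge0 // -[leRHS]mul1r.
  by rewrite ler_pM ?sqr_ge0.
(* Each entry of the product is E w12 plus three terms with coefficients at most 1, so it has the
   sign of w12, which the chosen sign makes positive. *)
have bnd p q t e : e = E * w12 + (p * w11 + q * (y ^+ 2 * w21) + t * w22) ->
    `|p| <= 1 -> `|q| <= 1 -> `|t| <= 1 ->
    1 <= (if 0 <= w12 then 1 else -1) * e <= E * o + 4 * o.
  move=> -> hp hq ht.
  have nM c z : `|c| <= 1 -> `|z| <= o -> `|c * z| <= o.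
    by move=> hc hz; rewrite normrM -[leRHS]mul1r ler_pM.
  have := nM _ _ hp a11; have := nM _ _ hq aY; have := nM _ _ ht a22.
  rewrite !ler_norml; move: (p * _) (q * _) (t * _) => u v r.
  move=> /andP[r1 r2] /andP[v1 v2] /andP[u1 u2].
  have Ek : E * d <= E * `|w12| <= E * o by rewrite !ler_wpM2l // ?kd ?a12.
  clear - Ed d0 o0 Ek r1 r2 v1 v2 u1 u2; move: Ek; case: (lerP 0 w12) => sg.
    by rewrite ger0_norm // mul1r => /andP[k1 k2]; apply/andP; split; lra.
  by rewrite ltr0_norm // mulrN mulN1r => /andP[k1 k2]; apply/andP; split; lra.
rewrite /P /Q mx2V // !mx2M; apply: ord2P; apply: ord2P; rewrite mxE !mx2E.
- apply: (bnd 2^-1 (- 4^-1) (- 2^-1)); rewrite ?normrN //.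
  by field: ex ex2.
- apply: (bnd (- 2^-1) 4^-1 (- 2^-1)); rewrite ?normrN //.
  by field: ex ex2.
- apply: (bnd 2^-1 4^-1 2^-1); rewrite ?normrN //.
  by field: ex ex2.
- apply: (bnd (- 2^-1) (- 4^-1) 2^-1); rewrite ?normrN //.
  by field: ex ex2.
Qed.
End Positive.

(** * Products of positive matrices *)

Section Chain.
Variable R : realType.
Implicit Types (A B P Q : 'M[R]_2).

Definition positive_mx P := forall i j, 0 < P i j.

Lemma positive_mxM A B : positive_mx A -> positive_mx B -> positive_mx (A * B).
Proof. by move=> hA hB i j; rewrite mulmx2E addr_gt0 // mulr_gt0. Qed.

(** Perron-Frobenius: the columns of [Q] are eigenvectors, the dominant one positive and the other
    of mixed signs. The attracting fixed point is thus positive, the repelling one negative. *)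
Lemma positive_axis P : \det P = 1 -> positive_mx P -> exists Q (l : R),
  [/\ \det Q = 1, 1 < l, P * Q = Q * mx2 l 0 0 l^-1 &
   [/\ 0 < Q 0 0, Q 0 1 < 0, 0 < Q 1 0 & 0 < Q 1 1]].
Proof.
have [a [b [c [d ->]]]] := mx2P P; rewrite det_mx2 => h pos.
have := pos 0 0; have := pos 0 1; have := pos 1 0; have := pos 1 1.
rewrite !mx2E => {pos} d0 c0 b0 a0.
have bc0 : 0 < b * c by rewrite mulr_gt0.
have tt : 0 < (a + d) ^+ 2 - 4.
  have : (a + d) ^+ 2 - 4 = (a - d) ^+ 2 + 4 * (b * c) by move: h; lra.
  by move=> ->; rewrite ltr_wpDl ?sqr_ge0 // mulr_gt0.
pose s := Num.sqrt ((a + d) ^+ 2 - 4); have s0 : 0 < s by rewrite sqrtr_gt0.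
have sE : s ^+ 2 = (a + d) ^+ 2 - 4 by rewrite sqr_sqrtr // ltW.
pose l := (a + d + s) / 2; pose m := (a + d - s) / 2.
have lm : l * m = 1 by rewrite /l /m; field: sE.
have [lpm lmm] : l + m = a + d /\ l - m = s by rewrite /l /m; split; field.
have char1 : (l - a) * (a - m) = b * c.
  have -> : (l - a) * (a - m) = (l + m) * a - l * m - a ^+ 2 by ring.
  by rewrite lpm lm; move: h; lra.
have l1 : 1 < l.
  by rewrite /l; nra.
have mV : l^-1 = m by apply: (mulfI (x := l)); rewrite ?divff ?lm // lt0r_neq0 //; lra.
have [la am] : 0 < l - a /\ 0 < a - m.
  have sum : (l - a) + (a - m) = s by rewrite -lmm; ring.
  by split; nra.
(* Scaling the eigenvectors by 1/k makes the determinant b (l - m) / k^2 equal to 1. *)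
pose k := Num.sqrt (b * s); have k0 : 0 < k by rewrite sqrtr_gt0 mulr_gt0.
have kE : k ^+ 2 = b * s by rewrite sqr_sqrtr // mulr_ge0 // ltW.
have k0' := lt0r_neq0 k0.
clearbody k l m s.
have dE : d = l + m - a by rewrite lpm; ring.
exists (mx2 (b / k) (- (b / k)) ((l - a) / k) ((a - m) / k)), l; split => //.
- rewrite det_mx2; transitivity (b * (l - m) / k ^+ 2); first by field.
  by rewrite kE lmm divff // mulf_neq0 // lt0r_neq0.
- rewrite mV !mx2M; congr mx2.
  + by field.
  + by field.
  + have : c * b + d * (l - a) = (l - a) * l.
      by rewrite [c * b]mulrC -char1 dE; ring.
    by move=> e; rewrite mulr0 addr0 !mulrA -mulrDl e; field.
  + have : - (c * b) + d * (a - m) = (a - m) * m.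
      by rewrite [c * b]mulrC -char1 dE; ring.
    by move=> e; rewrite mulr0 add0r mulrN !mulrA -mulNr -mulrDl e; field.
- by rewrite !mx2E oppr_lt0; split; rewrite divr_gt0.
Qed.

(** The columns of [Q] give the endpoints of the axis: one at least e^(L + 2T) / M, the other
    between -M and 0. The point i e^(t + T) is at depth T between them. *)
Lemma close_to_axis Q (M T L t : R) : \det Q = 1 ->
  0 < Q 0 0 -> Q 0 1 < 0 -> 0 < Q 1 0 -> 0 < Q 1 1 ->
  Q 1 0 * expR (L + 2 * T) <= M * Q 0 0 -> - Q 0 1 <= M * Q 1 1 ->
  0 <= t <= L -> 0 <= M -> M * expR (- T) <= 1 ->
  exists s, hdist (pt (geo (t + T))) (pt (Q * geo s)) <= 2 * (M * expR (- T)).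
Proof.
have [p1 [q1 [p2 [q2 ->]]]] := mx2P Q; rewrite det_mx2 !mx2E => dQ p10 q10 p20 q20 hp hq.
move=> /andP[t0 tL] M0 MT; pose a := t + T.
(* [al], [be] and the [x] below are the entries of the Gram matrix of the columns of
   [geo (- a) * Q], of determinant 1. *)
pose al := p1 ^+ 2 * expR (- a) + p2 ^+ 2 * expR a.
pose be := q1 ^+ 2 * expR (- a) + q2 ^+ 2 * expR a.
have al0 : 0 < al by rewrite addr_gt0 // mulr_gt0 ?expR_gt0 // exprn_gt0.
pose x := p1 * q1 * expR (- a) + p2 * q2 * expR a.
have ea := expRxMexpNx_1 a.
have ab : al * be = 1 + x ^+ 2.
  transitivity ((p1 * q2 - q1 * p2) ^+ 2 * (expR a * expR (- a)) + x ^+ 2).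
    by rewrite /al /be /x; ring.
  by rewrite dQ ea expr1n mulr1.
(* Seen from the axis, [- ln al] is the height of the given point. *)
exists (- ln al).
have -> : hdist (pt (geo (t + T))) (pt (mx2 p1 q1 p2 q2 * geo (- ln al))) =
    arcosh (1 + `|x| ^+ 2 / 2).
  rewrite hdistE chd_pt ?det1M ?det_geo ?det_mx2 //; congr arcosh.
  rewrite geoV nf_geoM opprK -/a /geo mx2M !mx2E.
  set e := expR (- ln al / 2); set f := expR (- (- ln al / 2)).
  have eE : e ^+ 2 = al^-1.
    by rewrite expr2 -expRD -[RHS]lnK ?posrE ?invr_gt0 // lnV ?posrE //; congr expR; field.
  have fE : f ^+ 2 = al.
    by rewrite expr2 -expRD -[RHS]lnK ?posrE //; congr expR; field.
  rewrite real_normK ?num_real //; transitivity ((e ^+ 2 * al + f ^+ 2 * be) / 2).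
    by rewrite /al /be; ring.
  by rewrite eE fE mulVf ?lt0r_neq0 // ab; field.
(* [x] is a sum of two terms of opposite signs, one per hypothesis on the endpoints; p1 q2 <= 1
   follows from the determinant. *)
have xM : `|x| <= M * expR (- T).
  have pq1 : p1 * q2 <= 1 by have := mulr_gt0 p20 (_ : 0 < - q1); rewrite oppr_gt0; nra.
  have pq0 : 0 < p1 * q2 by rewrite mulr_gt0.
  have h1 : p1 * (- q1) * expR (- a) <= M * expR (- T).
    apply: ler_pM; rewrite ?expR_ge0 //.
    + by rewrite mulr_ge0 ?oppr_ge0 // ltW.
    + by have := ler_wpM2l (ltW p10) hq; have := ler_wpM2l M0 pq1; lra.
    + by rewrite ler_expR /a; lra.
  have h2 : p2 * q2 * expR a <= M * expR (- T).
    have -> : expR a = expR (L + 2 * T) * expR (a - (L + 2 * T)).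
      by rewrite -expRD; congr expR; ring.
    rewrite mulrA; apply: ler_pM; rewrite ?expR_ge0 //.
    + by rewrite !mulr_ge0 ?expR_ge0 // ltW.
    + by have := ler_wpM2l (ltW q20) hp; have := ler_wpM2l M0 pq1; lra.
    + by rewrite ler_expR /a; lra.
  have h3 : 0 <= p1 * (- q1) * expR (- a).
    by rewrite !mulr_ge0 ?expR_ge0 ?oppr_ge0 // ltW.
  have h4 : 0 <= p2 * q2 * expR a by rewrite !mulr_ge0 ?expR_ge0 // ltW.
  by rewrite ler_norml /x; apply/andP; split; move: h1 h2 h3 h4; lra.
apply: le_trans (arcosh_small _) _; last by rewrite ler_wpM2l.
by rewrite normr_ge0 (le_trans xM).
Qed.

Section Sequence.
Variables (l : nat -> R) (u : nat -> 'M[R]_2) (M : R).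
Hypothesis l0 : forall j, 0 <= l j.
Hypothesis du : forall j, \det (u j) = 1.
Hypothesis uM : forall j i k, 1 <= u j i k <= M.

(** Alternately flow along a segment and apply its connecting matrix: the j-th start frame seen from
    the first one, up to sign and the group. *)
Fixpoint chain (j : nat) : 'M[R]_2 :=
  if j is j'.+1 then chain j' * (geo (l j') * u j') else 1.

Lemma det_link j : \det (geo (l j) * u j) = 1.
Proof. by rewrite det1M ?det_geo. Qed.

Lemma det_chain j : \det (chain j) = 1.
Proof. by elim: j => [|j IH] /=; [exact: det1|rewrite det1M // det_link]. Qed.

(** [B j] is the axis seen from the j-th frame. Its repelling column is controlled by moving
    forward, its attracting column by moving backward from N, and the translation length by the
    growth of the latter over one turn. *)
Lemma chain_axis (N : nat) : (0 < N)%N -> exists Q (tau : R),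
  [/\ \det Q = 1, 0 < tau /\ tau <= \sum_(j < N) (2 * ln (2 * M) + l j),
   chain N * Q = Q * geo tau &
   forall j, (j < N)%N -> let B := (chain j)^-1 * Q in
     [/\ 0 < B 0 0, B 0 1 < 0, 0 < B 1 0 & 0 < B 1 1] /\
     (B 1 0 * expR (l j) <= M * B 0 0 /\ - B 0 1 <= M * B 1 1)].
Proof.
move=> N0.
have uP j i k : 0 < u j i k by have /andP[h _] := uM j i k; lra.
have M1 : 1 <= M by have /andP[h1 h2] := uM 0 0 0; lra.
have linkP j : positive_mx (geo (l j) * u j).
  by apply: ord2P; apply: ord2P; rewrite mulmx2E !mx2E mul0r ?addr0 ?add0r
    mulr_gt0 ?expR_gt0.
have pos : positive_mx (chain N).
  case: N N0 => // n _; elim: n => [|n IH].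
    by rewrite /= mul1r; exact: linkP.
  exact: positive_mxM IH (linkP _).
have [Q [lam [dQ lam1 eQ [Q00 Q01 Q10 Q11]]]] := positive_axis (det_chain N) pos.
have lam0 : 0 < lam by lra.
pose B j := (chain j)^-1 * Q.
have B0 : B 0%N = Q by rewrite /B /= invr1 mul1r.
(* A full turn only rescales the columns, so signs and ratios return. *)
have BN : B N = Q * mx2 lam^-1 0 0 lam.
  have uc := det1_unit (det_chain N).
  apply: (mulrI uc); rewrite /B mulVKr // mulrA eQ -mulrA mx2M.
  by rewrite !(mulr0, mul0r, addr0, add0r) divff ?mulVf ?lt0r_neq0 // -mx2_1 mulr1.
have BS j : B j = geo (l j) * u j * B j.+1.
  rewrite /B /= invrM ?det1_unit ?det_chain ?det_link // mulrA.
  by rewrite mulVKr ?det1_unit ?det_link.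
(* The inverse of [u j] keeps the signs (-, +) of the second column and brings its ratio below [M],
   whatever it was; hence the bound starts at j = 1. *)
have fwd j : [/\ B j 0 1 < 0, 0 < B j 1 1 & (0 < j)%N -> - B j 0 1 <= M * B j 1 1].
  elim: j => [|j [b01 b11 _]]; first by rewrite B0.
  have -> : B j.+1 = (u j)^-1 * (geo (- l j) * B j).
    rewrite (BS j) -geoV -(mulrA (geo _)) mulKr ?mulKr ?det1_unit ?det_geo //.
  move: (du j) (uM j) b01 b11; have [a [b [c [d ->]]]] := mx2P (u j).
  have [p [q [r [s ->]]]] := mx2P (B j); rewrite det_mx2 => hu hM.
  rewrite mx2V // /geo !mx2M !mx2E mulNr opprK.
  have := hM 0 0; have := hM 0 1; have := hM 1 0; have := hM 1 1; rewrite !mx2E.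
  move=> /andP[d1 dM] /andP[c1 cM] /andP[b1 bM] /andP[a1 aM] q0 s0.
  rewrite !(mul0r, mulr0, add0r, addr0).
  have y0 : 0 < expR (- (l j / 2)) * - q by rewrite mulr_gt0 ?expR_gt0 // oppr_gt0.
  have x0 : 0 < expR (l j / 2) * s by rewrite mulr_gt0 ?expR_gt0.
  move: y0 x0; rewrite mulrN; move: (expR _ * q) (expR _ * s) => y x y0 x0.
  have hc : M * - y <= M * (c * - y) by rewrite ler_wpM2l //; [lra|nra].
  have ha : M * x <= M * (a * x) by rewrite ler_wpM2l //; [lra|nra].
  by split; [nra|nra|move=> _; nra].
have bwd k : (k <= N)%N -> 0 < B (N - k)%N 0 0 /\ 0 < B (N - k)%N 1 0.
  elim: k => [_|k IH kN].
    by rewrite subn0 BN mulmx2E mulmx2E !mx2E !mulr0 !addr0 !mulr_gt0 ?invr_gt0.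
  have [b0 b1] := IH (ltnW kN); rewrite BS subnSK //.
  by move: (geo _ * u _) (linkP (N - k.+1)%N) => W hW;
    split; rewrite mulmx2E addr_gt0 // mulr_gt0.
have pos0 j : (j <= N)%N -> 0 < B j 0 0 /\ 0 < B j 1 0.
  by move=> jN; have := bwd (N - j)%N (leq_subr _ _); rewrite subKn.
have step j : (j < N)%N -> [/\ B j 1 0 * expR (l j) <= M * B j 0 0 &
    B j 0 0 + B j 1 0 <= 2 * M * expR (l j / 2) * (B j.+1 0 0 + B j.+1 1 0)].
  move=> jN; have [] := pos0 j.+1 jN; rewrite (BS j).
  have := uM j; have [a [b [c [d ->]]]] := mx2P (u j).
  have [p [q [r [s ->]]]] := mx2P (B j.+1) => hM.
  have := hM 0 0; have := hM 0 1; have := hM 1 0; have := hM 1 1; rewrite !mx2E.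
  move=> /andP[d1 dM] /andP[c1 cM] /andP[b1 bM] /andP[a1 aM] p0 r0.
  rewrite /geo !mx2M !mx2E !(mul0r, mulr0, add0r, addr0).
  have -> : expR (l j) = expR (l j / 2) ^+ 2 by rewrite expr2 -expRD; congr expR; field.
  have := expRxMexpNx_1 (l j / 2); have : expR (- (l j / 2)) <= expR (l j / 2).
    by rewrite ler_expR; have := l0 j; lra.
  have := expR_gt0 (l j / 2); have := expR_gt0 (- (l j / 2)).
  move: (expR (l j / 2)) (expR (- _)) => x y y0 x0 yx xy.
  have pr k n : 1 <= k <= M -> 1 <= n <= M -> p + r <= k * p + n * r <= M * (p + r).
    by move=> /andP[? ?] /andP[? ?]; apply/andP; split; nra.
  have /andP[ab1 abM] := pr a b (introT andP (conj a1 aM)) (introT andP (conj b1 bM)).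
  have /andP[cd1 cdM] := pr c d (introT andP (conj c1 cM)) (introT andP (conj d1 dM)).
  split.
    have -> : (y * c * p + y * d * r) * x ^+ 2 = x * (c * p + d * r) by ring: xy.
    have -> : M * (x * a * p + x * b * r) = x * (M * (a * p + b * r)) by ring.
    by rewrite ler_pM2l // (le_trans cdM) // ler_wpM2l //; lra.
  have -> : x * a * p + x * b * r + (y * c * p + y * d * r) =
    x * (a * p + b * r) + y * (c * p + d * r) by ring.
  have -> : 2 * M * x * (p + r) = x * (M * (p + r)) + x * (M * (p + r)) by ring.
  by rewrite lerD // ?ler_pM2l // ler_pM //; [lra|nra].
(* Each link multiplies the sum of the first column by at most 2 M e^(l/2); over the whole turn the
   factor is [lam]. *)
have grow j : (j <= N)%N -> B 0%N 0 0 + B 0%N 1 0 <=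
    expR (\sum_(i < j) (ln (2 * M) + l i / 2)) * (B j 0 0 + B j 1 0).
  elim: j => [_|j IH jN]; first by rewrite big_ord0 expR0 mul1r.
  apply: le_trans (IH (ltnW jN)) _; rewrite big_ord_recr /= expRD -mulrA.
  rewrite ler_wpM2l ?expR_ge0 // expRD lnK ?posrE; last by lra.
  by have [_] := step _ jN.
have lamE : lam = expR (ln lam) by rewrite lnK.
(* [geo (2 * ln lam)] is the diagonal matrix with entries [lam] and its inverse. *)
exists Q, (2 * ln lam); split=> //.
- split; first by rewrite mulr_gt0 // ln_gt0.
  have := grow N (leqnn N); rewrite B0 BN !mulmx2E !mx2E !mulr0 !addr0 -mulrDl.
  move=> h; have {}h : lam <= expR (\sum_(i < N) (ln (2 * M) + l i / 2)).
    move: h; rewrite mulrA [leRHS]mulrAC; set S := Q 0 0 + Q 1 0.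
    have S0 : 0 < S by rewrite addr_gt0.
    by rewrite -[X in X <= _]mul1r ler_pM2r // ler_pdivlMr // mul1r.
  rewrite {1}lamE ler_expR in h; apply: le_trans (ler_wpM2l _ h) _ => //.
  by rewrite mulr_sumr ler_sum // => i _; rewrite mulrDr mulrCA divff ?mulr1.
- rewrite eQ /geo; congr (Q * mx2 _ _ _ _).
    by rewrite mulrC mulKf // lnK.
  by rewrite expRN mulrC mulKf // lnK.
move=> j jN /=; rewrite -/(B j); have [b01 b11 bM] := fwd j.
have [b00 b10] := pos0 j (ltnW jN); split=> //; split; first by have [] := step j jN.
(* At j = 0 the ratio is read off at j = N, where the column is proportional. *)
case: j jN b01 b11 bM {b00 b10} => [|j] jN b01 b11 bM; last exact: bM.
have [_ _ /(_ N0)] := fwd N; rewrite B0 BN !mulmx2E !mx2E !mulr0 !add0r.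
by rewrite -mulNr mulrA ler_pM2r.
Qed.
End Sequence.
End Chain.

(** * Closing up the prolonged segments into a geodesic *)

Lemma signZ_mul (R : realType) (s : R) (A : 'M[R]_2) : s = 1 \/ s = -1 ->
  s *: (s *: A) = A.
Proof. by case=> ->; rewrite scalerA ?mulrNN mulr1 scale1r. Qed.

Lemma pt_signZ (R : realType) (s : R) (A : 'M[R]_2) : s = 1 \/ s = -1 ->
  \det A = 1 -> pt (s *: A) = pt A.
Proof. by move=> + dA; case=> ->; rewrite ?scale1r ?scaleN1r ?ptN. Qed.

Lemma det_signZ (R : realType) (s : R) (A : 'M[R]_2) : s = 1 \/ s = -1 ->
  \det (s *: A) = \det A.
Proof. by case=> ->; rewrite ?scale1r ?scaleN1r ?det2N. Qed.

Theorem theorem2p4 (R : realType) (g : nat) (hg : (2 <= g)%N)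
    (X : closed_hyperbolic_surface R g) :
  exists K : R,
  forall (eps : R) (N : nat) (c : 'I_N -> geodesic_segment X),
    0 < eps < 1 -> (0 < N)%N ->
    let cbar := N%:R^-1 * \sum_(i < N) seg_length (c i) in
    exists gamma : closed_geodesic X,
      closed_length gamma <= N%:R * (K + cbar + 2 * ln (1 / eps)) /\
      forall i : 'I_N,
        seg_points (c i) `<=` neighborhood eps (closed_points gamma).
Proof.
have coc := compact_cocompact (@Defs.closed_compact _ _ X).
have [r r0 inj] := injectivity_radius coc.
have [M hM] := positive_connection coc.
have M1 : 1 <= M.
  have [k [s [_ _ /(_ 0 0) /andP[h1 h2]]]] := hM 1 1 (det1 _ _) (det1 _ _).
  exact: le_trans h2.
(* Each segment costs its length, 2 T for the prolongations and 2 ln (2 M) for the connection; 2 T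
   contributes 2 ln (1/eps) + 2 ln (2 M) + 2. *)
exists (4 * ln (2 * M) + 2) => eps N c /andP[eps0 eps1] N0 cbar.
have lnM : 0 <= ln (2 * M) by rewrite ln_ge0 //; lra.
have lne : 0 <= ln (1 / eps) by rewrite ln_ge0 // ler_pdivlMr // mul1r ltW.
(* With this [T], 2 M e^(-T) is eps divided by e; the summand 1 gives the strict inequality. *)
pose T := ln (1 / eps) + ln (2 * M) + 1.
have expT : 2 * (M * expR (- T)) < eps.
  have -> : - T = ln eps - ln (2 * M) - 1 by rewrite /T div1r lnV //; ring.
  rewrite !expRD !expRN !lnK ?posrE //; last by lra.
  have e1 : 1 < expR 1 :> R by rewrite expR_gt1.
  have -> : 2 * (M * (eps / (2 * M) / expR 1)) = eps / expR 1.
    by field; rewrite expR_eq0 lt0r_neq0 //; lra.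
  by rewrite ltr_pdivrMr ?expR_gt0 // ltr_pMr.
have T0 : 0 <= T by rewrite /T; lra.
have [A hA] : exists A : 'I_N -> 'M[R]_2, forall i, \det (A i) = 1 /\
    forall s, 0 <= s <= seg_length (c i) ->
      seg_map (c i) s = \pi_(surface X) (pt (A i * geo s)).
  suff /choice[A hA] : forall i, exists B : 'M[R]_2, \det B = 1 /\
      forall s, 0 <= s <= seg_length (c i) ->
        seg_map (c i) s = \pi_(surface X) (pt (B * geo s)) by exists A.
  by move=> i; have [B dB hB] := segment_lift r0 inj (c i); exists B.
(* Indices modulo N make the last segment connect back to the first. *)
pose idx (j : nat) : 'I_N := Ordinal (ltn_pmod j N0).
pose L j := seg_length (c (idx j)).
pose l j := L j + 2 * T.
have l0 j : 0 <= l j by rewrite addr_ge0 ?seg_length_ge0 // mulr_ge0.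
(* The start frame of the prolonged segment. *)
pose S j := A (idx j) * geo (- T).
have dS j : \det (S j) = 1 by have [dA _] := hA (idx j); rewrite det1M ?det_geo.
have SE j : S j = A (idx j) * geo (- T) by [].
clearbody S.
have dE j : \det (S j * geo (l j)) = 1 by rewrite det1M ?det_geo.
have [k hk] : exists k : nat -> 'M[R]_2 * R, forall j,
    [/\ fuchsian_set X (k j).1, (k j).2 = 1 \/ (k j).2 = -1 &
     forall a b, 1 <= ((k j).2 *: ((S j * geo (l j))^-1 * (k j).1 * S j.+1)) a b <= M].
  suff /choice[k hk] : forall j, exists p : 'M[R]_2 * R, [/\ fuchsian_set X p.1,
      p.2 = 1 \/ p.2 = -1 & forall a b,
      1 <= (p.2 *: ((S j * geo (l j))^-1 * p.1 * S j.+1)) a b <= M] by exists k.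
  by move=> j; have [h [s hs]] := hM _ _ (dE j) (dS j.+1); exists (h, s).
pose u j := (k j).2 *: ((S j * geo (l j))^-1 * (k j).1 * S j.+1).
have dk j : \det (k j).1 = 1 by have [Gk _ _] := hk j; exact: fuchsian_det Gk.
have du j : \det (u j) = 1.
  have [_ s1 _] := hk j; rewrite det_signZ //.
  exact: det1M (det1M (det1V (dE j)) (dk j)) (dS j.+1).
have uM j a b : 1 <= u j a b <= M by have [_ _] := hk j; exact.
have [Q [tau [dQ [tau0 tauE] eQ hQ]]] := chain_axis l0 du uM N0.
have dV j : \det (chain l u j) = 1 := det_chain l du j.
(* The composite of the connecting elements carries the j-th start frame onto the chain, up to
   sign. *)
have link j : exists h s, [/\ fuchsian_set X h, s = 1 \/ s = -1 &
    h * S j = s *: (S 0%N * chain l u j)].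
  elim: j => [|j [h [s [Gh s1 hE]]]].
    by exists 1, 1; rewrite mul1r mulr1 scale1r; split=> //; [exact: fuchsian1|left].
  have [Gk t1 _] := hk j.
  exists (h * (k j).1), (s * (k j).2); split; first exact: fuchsianM.
    by case: s1 => ->; case: t1 => ->; rewrite ?mulrNN ?mulr1 ?mul1r; auto.
  have kE : (k j).1 * S j.+1 = (k j).2 *: (S j * (geo (l j) * u j)).
    rewrite /u -!scalerAr signZ_mul // !mulrA divrr ?mul1r // ?det1_unit //.
  rewrite -mulrA kE -scalerAr (mulrA h) hE -scalerAl scalerA mulrC /=.
  by rewrite !mulrA.
have SN : S N = S 0%N
  by rewrite !SE (_ : idx N = idx 0%N) //; apply: val_inj; rewrite /= modnn mod0n.
pose gam t := \pi_(surface X) (pt (S 0%N * Q * geo t)).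
have dSQ : \det (S 0%N * Q) = 1 by rewrite det1M.
(* At j = N the start frame is the first one again, so the full chain acts on it as a group element
   up to sign, while it translates the axis by [tau]. *)
have per t : gam (t + tau) = gam t.
  have [h [s [Gh s1 hE]]] := link N; have dh := fuchsian_det Gh.
  rewrite /gam addrC geoD mulrA -(mulrA (S 0%N)) -eQ.
  have -> : S 0%N * (chain l u N * Q) * geo t = s *: (h * (S 0%N * Q * geo t)).
    rewrite !mulrA -SN hE SN -!scalerAl signZ_mul //.
  by rewrite pt_signZ ?det1M ?det_geo // pi_ptM ?det1M ?det_geo.
exists (ClosedGeodesic tau0 per (local_geodesic_pt inj r0 dSQ)); split => /=.
  apply: le_trans tauE _; rewrite /l big_split /= big_split /=.
  have -> : \sum_(j < N) L j = N%:R * cbar.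
    rewrite mulVKf ?pnatr_eq0 -?lt0n //; apply: eq_bigr => j _; rewrite /L.
    by congr (seg_length (c _)); apply: val_inj; rewrite /= modn_small.
  have sc (y : R) : \sum_(j < N) y = N%:R * y by rewrite sumr_const card_ord mulr_natl.
  rewrite !sc -!mulrDr; apply: ler_wpM2l => //; rewrite /T; move: cbar => y; lra.
move=> i p [t]; rewrite /= in_itv /= => ht <-.
have iE : idx i = i by apply: val_inj; rewrite /= modn_small.
have LE : L i = seg_length (c i) by rewrite /L iE.
have [dA /(_ t ht) ->] := hA i.
have [[b00 b01 b10 b11] [bp bq]] := hQ i (ltn_ord i).
have ui := det1_unit (dV i).
move: b00 b01 b10 b11 bp bq; set B := (chain l u i)^-1 * Q => b00 b01 b10 b11 bp bq.
have dB : \det B = 1 by rewrite det1M ?det1V.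
have MT : M * expR (- T) <= 1 by lra.
rewrite -LE in ht.
have [s hs] := close_to_axis dB b00 b01 b10 b11 bp bq ht (le_trans ler01 M1) MT.
have [h [e [Gh e1 hE]]] := link i; have dh := fuchsian_det Gh.
exists (gam s); first by exists s.
(* The same group element, inverted, brings the axis into the frame of the i-th segment, where
   [close_to_axis] compares them. *)
have -> : gam s = \pi_(surface X) (pt (S i * (B * geo s))).
  have -> : S i * (B * geo s) = h^-1 * (e *: (S 0%N * Q * geo s)).
    apply: (mulrI (det1_unit dh)); rewrite mulVKr ?det1_unit // (mulrA h) hE -scalerAl.
    by congr (_ *: _); rewrite /B -!mulrA mulVKr.
  have dSQs : \det (S 0%N * Q * geo s) = 1 by rewrite det1M ?det_geo.
  by rewrite pi_ptM ?det_signZ ?pt_signZ //; exact: fuchsianV.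
have -> : A i * geo t = S i * geo (t + T).
  by rewrite SE iE -mulrA -geoD addrCA addNr addr0.
apply: le_lt_trans (sdist_le _ _ _) _.
rewrite hdistE (chd_ptM (dS i) (det_geo _) (det1M dB (det_geo s))) -hdistE.
exact: le_lt_trans hs expT.
Qed.
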